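(* Let $f\colon\mathbb{R}^{m\times n}\to\mathbb{R}$ be continuously differentiable, and assume $f$ is twice continuously differentiable on a neighborhood of $\mathbb{R}^{m\times n}_{\le r}$. Let $g\colon\mathcal{M}\to\mathbb{R}$, $g(X,P)=f(X)$. Then for all $(X,P)\in\mathcal{M}$ the Riemannian Hessian of $g$ is bounded as $$\|\nabla^2g(X,P)\|_{\mathrm{op}}\le\|\nabla^2f(X)\|_{\mathrm{op}}+\big(2\alpha+\sigma_r(X)^2\big)^{-\frac12}\,\|\nabla f(X)P\|_2 .$$
   Context: Let $m,n,r$ be positive integers with $r<\min(m,n)$. $\mathrm{Sym}(n)$: real symmetric $n\times n$ matrices; $\mathrm{Gr}(n,n-r)=\{P\in\mathrm{Sym}(n):P^2=P,\ \mathrm{rank}\,P=n-r\}$; $\mathbb{R}^{m\times n}_{\le r}$ is the set of real $m\times n$ matrices of rank at most $r$. The desingularization $\mathcal{M}=\{(X,P)\in\mathbb{R}^{m\times n}\times\mathrm{Gr}(n,n-r):XP=0\}$ is a smooth embedded submanifold of $\mathcal{E}=\mathbb{R}^{m\times n}\times\mathrm{Sym}(n)$. $\mathcal{M}$ is a Riemannian submanifold of $\mathcal{E}$ with inner product $\langle(Y_1,Z_1),(Y_2,Z_2)\rangle=\langle Y_1,Y_2\rangle+\alpha\langle Z_1,Z_2\rangle$, $\alpha>0$ fixed (Frobenius inner products on the right). $\nabla f$ and $\nabla^2f$ are the Euclidean gradient and Hessian of $f$ (Frobenius inner product), $\|\cdot\|_{\mathrm{op}}$ is the operator norm of a linear operator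 (with respect to the norms of $\mathrm{T}_{(X,P)}\mathcal{M}$ and the Frobenius norm on $\mathbb{R}^{m\times n}$, respectively), $\|\cdot\|_2$ is the spectral norm of a matrix, and $\sigma_1(X)\ge\sigma_2(X)\ge\cdots$ are the singular values of $X$. *)

(* Defs.v *)
From HB Require Import structures.
From mathcomp Require Export all_boot all_order all_algebra.
From mathcomp Require Export all_classical all_reals all_analysis.
Export Order.TTheory GRing.Theory Num.Theory.
Export numFieldNormedType.Exports.

Set Implicit Arguments.
Unset Strict Implicit.
Unset Printing Implicit Defensive.

Local Open Scope classical_set_scope.
Local Open Scope ring_scope.

Definition ip_norm (R : realType) (V : Type) (ip : V -> V -> R) (v : V) : R :=
  Num.sqrt (ip v v).

(* The supremum is attained and finite when [T] is a finite-dimensional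
   subspace, [nV] and [nW] are norms and [L] is linear on [T]. *)
Definition op_norm (R : realType) (V W : Type) (T : set V)
    (nV : V -> R) (nW : W -> R) (L : V -> W) : R :=
  sup [set nW (L v) | v in [set v | T v /\ nV v <= 1]].

(* The library's norm on matrices is the maximum norm; it induces the same
   topology and derivatives as the Frobenius norm. *)
Definition frob (R : realType) (m n : nat) (A B : 'M[R]_(m, n)) : R :=
  \tr (A^T *m B).

Definition frob_norm (R : realType) (m n : nat) : 'M[R]_(m, n) -> R :=
  ip_norm (@frob R m n).

Definition spectral_norm (R : realType) (m n : nat) (A : 'M[R]_(m, n)) : R :=
  op_norm setT (@frob_norm R n 1) (@frob_norm R m 1) (mulmx A).

(* Square roots of the eigenvalues of [X^T X], with multiplicity, in
   nonincreasing order (such a sequence exists and is unique).  There are [n]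
   of them: the [minn m n] usual singular values followed by zeros. *)
Definition singular_values (R : realType) (m n : nat) (X : 'M[R]_(m, n)) :
    seq R :=
  xget [::] [set s : seq R |
    [/\ sorted (fun x y => y <= x) s, all (fun x => 0 <= x) s
      & char_poly (X^T *m X) = \prod_(x <- s) ('X - (x ^+ 2)%:P)]].

(* Indexed from 1. *)
Definition sigma (R : realType) (m n : nat) (k : nat) (X : 'M[R]_(m, n)) : R :=
  (singular_values X)`_k.-1.

(* Continuity of every directional derivative is continuity of the
   differential when [V] is finite-dimensional. *)
Definition C1_on (R : realType) (V W : normedModType R) (U : set V)
    (F : V -> W) : Prop :=
  forall x, U x ->
    differentiable F x /\ forall v, {for x, continuous ('D_v F)}.

Definition egrad (R : realType) (m n : nat) (f : 'M[R]_(m, n) -> R)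
    (X : 'M[R]_(m, n)) : 'M[R]_(m, n) :=
  \matrix_(i, j) 'D_(delta_mx i j) f X.

Definition ehess (R : realType) (m n : nat) (f : 'M[R]_(m, n) -> R)
    (X V : 'M[R]_(m, n)) : 'M[R]_(m, n) :=
  'D_V (egrad f) X.

Definition C2_on (R : realType) (m n : nat) (U : set 'M[R]_(m, n))
    (f : 'M[R]_(m, n) -> R) : Prop :=
  C1_on U (f : _ -> R^o) /\ C1_on U (egrad f).

(* Riemannian submanifolds of a Euclidean space:
   [V] is a finite-dimensional space with inner product [ip], and [M] is (the
   carrier of) a smooth embedded submanifold of [V] with the induced metric.
   Functions on [M] are given as functions on [V]; only their values on [M]
   matter below. *)
Section RiemannianSubmanifold.
Context {R : realType} {V : normedModType R}.
Variables (ip : V -> V -> R) (M : set V).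

(* Smooth curves in [M], defined on an open interval around 0. *)
Definition smooth_curve (c : R -> V) : Prop :=
  exists2 e : R, 0 < e & forall t, `|t| < e ->
    M (c t) /\ forall k, derivable (derive1n k c) t 1.

Definition curve_through (p v : V) (c : R -> V) : Prop :=
  [/\ smooth_curve c, c 0 = p & derive1 c 0 = v].

Definition tangent (p : V) : set V := [set v | exists c, curve_through p v c].

Definition is_riem_grad (g : V -> R) (p G : V) : Prop :=
  tangent p G /\
  forall v c, curve_through p v c -> is_derive (0 : R) 1 (g \o c) (ip G v).

Definition riem_grad (g : V -> R) (p : V) : V :=
  xget 0 [set G | is_riem_grad g p G].

Definition is_orth_proj (T : set V) (y z : V) : Prop :=
  T z /\ forall t, T t -> ip (y - z) t = 0.

(* [w] is the covariant derivative at [p] in the direction [v] of the vector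
   field [Z] on [M].  The Levi-Civita connection of a Riemannian submanifold
   of a Euclidean space is the tangential part of the ambient derivative. *)
Definition is_cov_deriv (Z : V -> V) (p v w : V) : Prop :=
  forall c, curve_through p v c ->
    derivable (Z \o c) 0 1 /\ is_orth_proj (tangent p) (derive1 (Z \o c) 0) w.

Definition riem_hess (g : V -> R) (p v : V) : V :=
  xget 0 [set w | is_cov_deriv (riem_grad g) p v w].

(* The choices in [riem_grad] and [riem_hess] are made from nonempty sets:
   [g] has a gradient field on [M], and a Hessian at [p]. *)
Definition has_riem_hess (g : V -> R) (p : V) : Prop :=
  (forall q, M q -> is_riem_grad g q (riem_grad g q)) /\
  forall v, tangent p v -> is_cov_deriv (riem_grad g) p v (riem_hess g p v).

End RiemannianSubmanifold.

(* Symmetric matrices are kept inside ['M_n]: tangent spaces, gradients and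
   Hessians of a submanifold depend only on the induced metric. *)
Definition Gr (R : realType) (n d : nat) : set 'M[R]_n :=
  [set P | [/\ P^T = P, P *m P = P & \rank P = d]].

Definition desing (R : realType) (m n r : nat) :
    set ('M[R]_(m, n) * 'M[R]_n)%type :=
  [set XP | Gr (n - r) XP.2 /\ XP.1 *m XP.2 = 0].

Definition ip_E (R : realType) (m n : nat) (alpha : R)
    (u v : 'M[R]_(m, n) * 'M[R]_n) : R :=
  frob u.1 v.1 + alpha * frob u.2 v.2.

Definition lift_fun (R : realType) (m n : nat) (f : 'M[R]_(m, n) -> R)
    (XP : 'M[R]_(m, n) * 'M[R]_n) : R := f XP.1.

(* Main.v *)
Require Import Defs.
From mathcomp Require Import perm ring lra zify.

(* The tangent space at [(X, P)] consists of the vectors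
   [(K - X C, C + C^T)] with [K P = 0], [P C = 0], [C P = C], and the Cayley
   transform provides a rational curve through each of them.  With
   [H = 2 alpha + X^T X], orthogonal projection onto it amounts to solving one
   linear system with matrix [H].  Differentiating
   [<grad g, u> = <egrad f, u.1>] along a curve, for a tangent field [u]
   extending [(K - X C, C + C^T)], gives for [v = (L - X E, E + E^T)]
     [<u, Hess g v> = <u.1, ehess f v.1> - <N, K E + L C>],
   where [N = (1 - X H^-1 X^T) (egrad f) P] is the image of [(egrad f) P] under
   a contraction.  Finally [|u|^2 >= |K|^2 + (2 alpha + sigma_r^2) |C|^2], and
   Cauchy-Schwarz bounds [|K| |E| + |L| |C|] by
   [|u| |v| / sqrt (2 alpha + sigma_r^2)]. *)

Set Implicit Arguments.
Unset Strict Implicit.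
Unset Printing Implicit Defensive.

Local Open Scope classical_set_scope.
Local Open Scope ring_scope.

(** * Inner products and operator norms *)

Definition inner_product (R : realType) (V : lmodType R) (ip : V -> V -> R) :=
  [/\ forall u v, ip u v = ip v u,
      forall a u v w, ip (a *: u + v) w = a * ip u w + ip v w,
      forall u, 0 <= ip u u
    & forall u, ip u u = 0 -> u = 0].

Section InnerProduct.
Context (R : realType) (V : lmodType R) (ip : V -> V -> R).
Hypothesis ipP : inner_product ip.

Local Notation norm := (ip_norm ip).

Lemma ipC u v : ip u v = ip v u. Proof. by case: ipP. Qed.

Lemma ip_linear a u v w : ip (a *: u + v) w = a * ip u w + ip v w.
Proof. by case: ipP. Qed.

Lemma ip_ge0 u : 0 <= ip u u. Proof. by case: ipP. Qed.

Lemma ip_eq0 u : ip u u = 0 -> u = 0. Proof. by case: ipP => _ _ _; exact. Qed.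

Lemma ipDl u v w : ip (u + v) w = ip u w + ip v w.
Proof. by rewrite -[u]scale1r ip_linear mul1r scale1r. Qed.

Lemma ip0l w : ip 0 w = 0.
Proof. by apply: (addrI (ip 0 w)); rewrite -ipDl !addr0. Qed.

Lemma ipZl a u w : ip (a *: u) w = a * ip u w.
Proof. by rewrite -[a *: u]addr0 ip_linear ip0l addr0. Qed.

Lemma ipNl u w : ip (- u) w = - ip u w.
Proof. by rewrite -scaleN1r ipZl mulN1r. Qed.

Lemma ipBl u v w : ip (u - v) w = ip u w - ip v w.
Proof. by rewrite ipDl ipNl. Qed.

Lemma ip0r w : ip w 0 = 0. Proof. by rewrite ipC ip0l. Qed.

Lemma ipDr u v w : ip w (u + v) = ip w u + ip w v.
Proof. by rewrite !(ipC w) ipDl. Qed.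

Lemma ipZr a u w : ip w (a *: u) = a * ip w u.
Proof. by rewrite !(ipC w) ipZl. Qed.

Lemma ipNr u w : ip w (- u) = - ip w u.
Proof. by rewrite !(ipC w) ipNl. Qed.

Lemma ipBr u v w : ip w (u - v) = ip w u - ip w v.
Proof. by rewrite !(ipC w) ipBl. Qed.

Lemma ip_norm_ge0 u : 0 <= norm u. Proof. exact: sqrtr_ge0. Qed.

Lemma ip_norm_sqr u : norm u ^+ 2 = ip u u.
Proof. by rewrite sqr_sqrtr ?ip_ge0. Qed.

Lemma ip_norm_eq0 u : norm u = 0 -> u = 0.
Proof. by move=> u0; apply: ip_eq0; rewrite -ip_norm_sqr u0 expr0n. Qed.

Lemma ip_normZ a u : norm (a *: u) = `|a| * norm u.
Proof.
rewrite /ip_norm ipZl ipZr mulrA -expr2 sqrtrM ?sqr_ge0//.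
by rewrite sqrtr_sqr.
Qed.

Lemma ip_cauchy_schwarz u v : ip u v <= norm u * norm v.
Proof.
have [v0|v0] := eqVneq (ip v v) 0.
  by rewrite (ip_eq0 v0) ip0r mulr_ge0 ?ip_norm_ge0.
have vgt0 : 0 < ip v v by rewrite lt_neqAle eq_sym v0 ip_ge0.
have := ip_ge0 (ip v v *: u - ip u v *: v).
rewrite !(ipBl, ipBr, ipZl, ipZr) (ipC v u) => H.
have {}H : 0 <= ip v v * (ip u u * ip v v - ip u v ^+ 2) by lra.
move: H; rewrite pmulr_rge0 // subr_ge0 -(ip_norm_sqr u) -(ip_norm_sqr v).
rewrite -exprMn => H.
apply: le_trans (ler_norm _) _.
rewrite -(@ler_pXn2r _ 2) ?nnegrE ?mulr_ge0 ?ip_norm_ge0//.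
by rewrite real_normK // num_real.
Qed.

Lemma ip_norm_triangle u v : norm (u + v) <= norm u + norm v.
Proof.
rewrite -(@ler_pXn2r _ 2) ?nnegrE ?addr_ge0 ?ip_norm_ge0//.
rewrite sqrrD !ip_norm_sqr !(ipDl, ipDr) (ipC v u).
have := ip_cauchy_schwarz u v; lra.
Qed.

End InnerProduct.

Section Frobenius.
Context (R : realType).

Lemma frobE m n (A B : 'M[R]_(m, n)) : frob A B = \sum_i \sum_j A i j * B i j.
Proof.
rewrite /frob /mxtrace exchange_big; apply: eq_bigr => j _; rewrite mxE.
by apply: eq_bigr => i _; rewrite mxE.
Qed.

Lemma inner_frob m n : inner_product (@frob R m n).
Proof.
split.
- by move=> A B; rewrite /frob -mxtrace_tr trmx_mul trmxK.
- move=> a A B C; rewrite /frob linearP /= mulmxDl -scalemxAl.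
  by rewrite mxtraceD mxtraceZ.
- by move=> A; rewrite frobE; do 2 apply: sumr_ge0 => ? _; exact: sqr_ge0.
- move=> A; rewrite frobE => A0; apply/matrixP => i j; rewrite !mxE.
  have sq k l : 0 <= A k l * A k l by exact: sqr_ge0.
  have Ai : \sum_j A i j * A i j = 0.
    by apply: (psumr_eq0P _ A0) => // k _; exact: sumr_ge0.
  have /eqP : A i j * A i j = 0 by apply: (psumr_eq0P _ Ai).
  by rewrite mulf_eq0 orbb => /eqP.
Qed.

Lemma frob_mull m n p (A : 'M[R]_(m, n)) (B : 'M[R]_(n, p)) C :
  frob (A *m B) C = frob B (A^T *m C).
Proof. by rewrite /frob trmx_mul mulmxA. Qed.

Lemma frob_mulr m n p (A : 'M[R]_(m, n)) (B : 'M[R]_(n, p)) C :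
  frob (A *m B) C = frob A (C *m B^T).
Proof. by rewrite /frob trmx_mul -mulmxA mxtrace_mulC mulmxA. Qed.

Lemma frob_tr m n (A B : 'M[R]_(m, n)) : frob A^T B^T = frob A B.
Proof.
by rewrite /frob trmxK mxtrace_mulC -mxtrace_tr trmx_mul trmxK.
Qed.

Lemma frob_norm_tr m n (A : 'M[R]_(m, n)) : frob_norm A^T = frob_norm A.
Proof. by rewrite /frob_norm /ip_norm frob_tr. Qed.

Lemma frob_norm_sqr m n (A : 'M[R]_(m, n)) : frob_norm A ^+ 2 = frob A A.
Proof. exact: (ip_norm_sqr (inner_frob m n)). Qed.

Lemma inner_ip_E m n (alpha : R) : 0 < alpha ->
  inner_product (@ip_E R m n alpha).
Proof.
move=> a_gt0; rewrite /ip_E; split=> [[A B] [C D]|a [A B] [C D] [E F]|[A B]|[A B]]/=.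
- by rewrite (ipC (inner_frob _ _)) (ipC (inner_frob _ _) B).
- by rewrite !(ip_linear (inner_frob _ _)); ring.
- have := ip_ge0 (inner_frob _ _) A; have := ip_ge0 (inner_frob _ _) B; nra.
- have A0 := ip_ge0 (inner_frob _ _) A; have B0 := ip_ge0 (inner_frob _ _) B.
  move=> AB; have HA : frob A A = 0 by nra.
  have HB : frob B B = 0 by nra.
  by rewrite (ip_eq0 (inner_frob _ _) HA) (ip_eq0 (inner_frob _ _) HB).
Qed.

Lemma frob_norm_sum_le m n I (s : seq I) (F : I -> 'M[R]_(m, n)) :
  frob_norm (\sum_(i <- s) F i) <= \sum_(i <- s) frob_norm (F i).
Proof.
elim/big_ind2: _ => [|x A y B Ax By|//].
  by rewrite /frob_norm /ip_norm (ip0l (inner_frob _ _)) sqrtr0.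
exact: (le_trans (ip_norm_triangle (inner_frob m n) A B) (lerD Ax By)).
Qed.

Lemma le_frob_norm m n (A : 'M[R]_(m, n)) i j : `|A i j| <= frob_norm A.
Proof.
rewrite -(@ler_pXn2r _ 2) ?nnegrE ?ip_norm_ge0 ?normr_ge0 //.
rewrite frob_norm_sqr real_normK ?num_real // frobE.
rewrite (bigD1 i) //= (bigD1 j) //= -expr2 -addrA lerDl.
rewrite addr_ge0 // !sumr_ge0 // => ? _; rewrite ?sumr_ge0 // => *;
  exact: sqr_ge0.
Qed.

(** By homogeneity the claim is about unit vectors, where it says that [sup] is an upper bound. This
    needs the image of the unit ball to be bounded, since [sup] of an unbounded set is 0. *)
Lemma frob_norm_le_op_norm m n p q (L : {linear 'M[R]_(m, n) -> 'M[R]_(p, q)}) V :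
  frob_norm (L V) <=
  op_norm setT (@frob_norm R m n) (@frob_norm R p q) L * frob_norm V.
Proof.
have [V0|V0] := eqVneq (frob_norm V) 0.
  rewrite V0 mulr0 (ip_norm_eq0 (inner_frob _ _) V0) linear0.
  by rewrite /frob_norm /ip_norm (ip0l (inner_frob _ _)) sqrtr0.
have Vgt0 : 0 < frob_norm V by rewrite lt_neqAle eq_sym V0 ip_norm_ge0.
rewrite -ler_pdivrMr // mulrC -[(frob_norm V)^-1]ger0_norm ?invr_ge0 ?(ltW Vgt0) //.
rewrite -(ip_normZ (inner_frob _ _)) -linearZ.
apply: ub_le_sup; last first.
  exists ((frob_norm V)^-1 *: V) => //; split=> //=.
  rewrite /frob_norm (ip_normZ (inner_frob _ _)) -/(frob_norm V).
  by rewrite ger0_norm ?invr_ge0 ?(ltW Vgt0) // mulVf.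
(* Expand [W] in matrix units: its coefficients are at most 1 in absolute value, being bounded by
   its Frobenius norm. *)
exists (\sum_i \sum_j frob_norm (L (delta_mx i j))) => _ [W [_ W1] <-].
rewrite {1}(matrix_sum_delta W) linear_sum.
apply: le_trans (frob_norm_sum_le _ _) _; apply: ler_sum => i _.
rewrite linear_sum; apply: le_trans (frob_norm_sum_le _ _) _.
apply: ler_sum => j _; rewrite linearZ /frob_norm (ip_normZ (inner_frob _ _)).
rewrite ler_piMl ?ip_norm_ge0 //.
exact: le_trans (le_frob_norm _ _ _) W1.
Qed.

(** If the set of values is empty or unbounded, [sup] takes its default value 0; otherwise it
    dominates a nonnegative element. *)
Lemma op_norm_ge0 (V W : Type) (T : set V) (nV : V -> R) (nW : W -> R) L :
  (forall w, 0 <= nW w) -> 0 <= op_norm T nV nW L.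
Proof.
move=> nW0; rewrite /op_norm; set S := image _ _.
have [[[_ [v Tv _]] ubS]|supS] := pselect (has_sup S); last by rewrite sup_out.
by apply: le_trans (nW0 (L v)) _; apply: ub_le_sup => //; exists v.
Qed.

Lemma frob_col n p (B C : 'M[R]_(n, p)) :
  frob B C = \sum_j frob (col j B) (col j C).
Proof.
rewrite /frob /mxtrace; apply: eq_bigr => j _.
by rewrite big_ord1 !mxE; apply: eq_bigr => i _; rewrite !mxE.
Qed.

(** The squared Frobenius norm is the sum over columns, and the spectral norm bounds the action of
    [A] on each column. *)
Lemma frob_norm_mulmx_le m n p (A : 'M[R]_(m, n)) (B : 'M[R]_(n, p)) :
  frob_norm (A *m B) <= spectral_norm A * frob_norm B.
Proof.
have A0 : 0 <= spectral_norm A by apply: op_norm_ge0 => w; exact: ip_norm_ge0.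
rewrite -(@ler_pXn2r _ 2) ?nnegrE ?mulr_ge0 ?ip_norm_ge0//.
rewrite exprMn !frob_norm_sqr frob_col (frob_col B) mulr_sumr.
apply: ler_sum => j _.
rewrite -!frob_norm_sqr -exprMn colE -mulmxA -colE.
rewrite ler_pXn2r ?nnegrE ?mulr_ge0 ?ip_norm_ge0//.
exact: (frob_norm_le_op_norm (mulmx A)).
Qed.

End Frobenius.

Arguments inner_frob {R} m n.

(** * The smallest nonzero singular value *)

Section CharPoly.
Variable F : fieldType.

(** A zero row of [A] leaves only the diagonal entry 'X in that row of the characteristic matrix, so
    one factor 'X can be pulled out of each row of index at least r. *)
Lemma Xn_dvd_char_poly_row0 n r (A : 'M[F]_n) :
  (forall i j : 'I_n, (r <= i)%N -> A i j = 0) -> 'X^(n - r) %| char_poly A.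
Proof.
move=> A0; set d : 'rV[{poly F}]_n := \row_i (if (i < r)%N then 1 else 'X).
have -> : char_poly A = \det (diag_mx d *m
    (\matrix_(i, j) if (i < r)%N then char_poly_mx A i j else (i == j)%:R)).
  congr (\det _); apply/matrixP => i j; rewrite mul_diag_mx !mxE.
  case: ltnP => [_|ri]; first by rewrite mul1r.
  by rewrite A0 // subr0 mulr_natr.
rewrite det_mulmx det_diag; apply: dvdp_mulr.
under eq_bigr do rewrite mxE.
rewrite (bigID (fun i : 'I_n => (i < r)%N)) /= dvdp_mull //.
under eq_bigr => i /negbTE -> do [].
rewrite prodr_const dvdp_exp2l //.
(* It remains to count: at most r indices lie below r, whether or not r exceeds n. *)
rewrite (eq_card (B := [predC [pred i : 'I_n | (i < r)%N]])); last by move=> i.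
rewrite -[n in (n - r)%N]card_ord -(cardC [pred i : 'I_n | (i < r)%N]).
rewrite leq_subLR leq_add2r; have [rn|/ltnW nr] := leqP r n.
  by rewrite -sum1_card (big_ord_narrow rn) sum1_card card_ord.
by rewrite (leq_trans (max_card _)) // card_ord.
Qed.

(** The algebraic multiplicity of the eigenvalue 0 is at least the nullity. Conjugating by the
    column basis [L] of the rank factorization turns [A] into [A'], whose rows from index [\rank A]
    on vanish. *)
Lemma Xn_dvd_char_poly n (A : 'M[F]_n) : 'X^(n - \rank A) %| char_poly A.
Proof.
pose L := col_ebase A; pose A' : 'M[F]_n := pid_mx (\rank A) *m row_ebase A *m L.
have LA : L *m A' = A *m L by rewrite !mulmxA mulmx_ebase.
have /Xn_dvd_char_poly_row0 : forall i j : 'I_n, (\rank A <= i)%N -> A' i j = 0.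
  move=> i j ri; rewrite /A' -mulmxA mxE big1 // => k _.
  by rewrite mxE ltnNge ri andbF mul0r.
suff -> : char_poly A' = char_poly A by [].
have detL : \det (map_mx polyC L) != 0.
  by rewrite det_map_mx polyC_eq0 -unitfE -unitmxE col_ebase_unit.
(* Similar matrices have equal characteristic polynomials: multiply both sides by the nonzero
   constant [\det L] and use [L A' = A L], avoiding the inverse of [L]. *)
apply: (mulfI detL); rewrite -det_mulmx mulrC -det_mulmx; congr (\det _).
rewrite /char_poly_mx mulmxBr mulmxBl -map_mxM LA map_mxM.
by rewrite scalar_mxC.
Qed.

End CharPoly.

Section SymmetricAnnihilator.
Variable R : realType.

Lemma horner_mx_eigen n p (A : 'M[R]_n.+1) a (E : 'M[R]_(n.+1, p)) h :
  A *m E = a *: E -> horner_mx A h *m E = h.[a] *: E.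
Proof.
move=> AE; elim/poly_ind: h => [|h c IH].
  by rewrite horner0 rmorph0 mul0mx scale0r.
rewrite rmorphD rmorphM /= horner_mx_X horner_mx_C mulmxDl.
rewrite -mulmxE -mulmxA AE -scalemxAr IH mul_scalar_mx.
by rewrite !hornerE scalerA scalerDl mulrC.
Qed.

Lemma horner_mx_tr n (A : 'M[R]_n.+1) h :
  (horner_mx A h)^T = horner_mx A^T h.
Proof.
elim/poly_ind: h => [|h c IH]; first by rewrite !rmorph0 trmx0.
rewrite !rmorphD !rmorphM /= !horner_mx_X !horner_mx_C linearD /= tr_scalar_mx.
rewrite -!mulmxE trmx_mul IH; congr (_ + _).
exact/comm_mx_horner/comm_mx_refl.
Qed.

(* Peels off eigencomponents one root at a time; repeated roots collapse because
   [(A - a)^2 C = 0] implies [(A - a) C = 0] for symmetric [A]. *)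
Lemma sym_annihilated_lower_bound n p (A : 'M[R]_n.+1) (B : 'M[R]_(n.+1, p))
    (s : seq R) tau :
  A^T = A -> {in s, forall a, tau <= a} ->
  horner_mx A (\prod_(a <- s) ('X - a%:P)) *m B = 0 ->
  tau * frob B B <= frob (A *m B) B.
Proof.
move=> At; elim: s B => [|a s IH] B tau_le.
  rewrite big_nil rmorph1 mul1mx => ->.
  by rewrite !(ip0r (inner_frob _ _)) mulr0.
have tau_s : {in s, forall a, tau <= a}.
  by move=> x xs; apply: tau_le; rewrite inE xs orbT.
have frobA (C D : 'M[R]_(n.+1, p)) : frob (A *m C) D = frob C (A *m D).
  by rewrite frob_mull At.
rewrite big_cons; set h := \prod_(_ <- _) _ => hB.
have [ha|ha] := eqVneq h.[a] 0.
  apply: IH => //; rewrite -/h.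
  have [h' hE] : exists h', h = h' * ('X - a%:P) by apply/factor_theorem/eqP.
  have facE q : horner_mx A (q * ('X - a%:P)) *m B =
      A *m (horner_mx A q *m B) - a *: (horner_mx A q *m B).
    rewrite mulrC rmorphM rmorphB /= horner_mx_X horner_mx_C.
    by rewrite -mulmxE -mulmxA mulmxBl mul_scalar_mx.
  move: hB; rewrite mulrC facE hE facE; set C := horner_mx A h' *m B => AC.
  apply: (ip_eq0 (inner_frob _ _)).
  rewrite (ipBl (inner_frob _ _)) (ipZl (inner_frob _ _)) frobA.
  rewrite -(ipZr (inner_frob _ _)) -(ipBr (inner_frob _ _)) AC.
  by rewrite (ip0r (inner_frob _ _)).
pose E := h.[a]^-1 *: (horner_mx A h *m B); pose D := B - E.
have AE : A *m E = a *: E.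
  apply/eqP; rewrite -subr_eq0 /E -scalemxAr scalerA mulrC -scalerA -scalerBr.
  move: hB; rewrite rmorphM rmorphB /= horner_mx_X horner_mx_C.
  by rewrite -mulmxE -mulmxA mulmxBl mul_scalar_mx => ->; rewrite scaler0.
have hD : horner_mx A h *m D = 0.
  rewrite mulmxBr (horner_mx_eigen h AE) /E scalerA divff // scale1r.
  by rewrite subrr.
have ED : frob E D = 0.
  apply: (mulfI ha); rewrite mulr0 -(ipZl (inner_frob _ _)).
  rewrite -(horner_mx_eigen h AE) frob_mull horner_mx_tr At hD.
  by rewrite (ip0r (inner_frob _ _)).
have := IH D tau_s hD.
have -> : B = E + D by rewrite addrC subrK.
clearbody D E.
have Ege0 := ip_ge0 (inner_frob _ _) E.
have tau_a : tau <= a by apply: tau_le; rewrite inE eqxx.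
rewrite mulmxDr AE !(ipDl (inner_frob _ _), ipDr (inner_frob _ _)).
rewrite (frobA D E) AE !(ipZl (inner_frob _ _), ipZr (inner_frob _ _)).
rewrite (ipC (inner_frob _ _) D E) ED; nra.
Qed.

End SymmetricAnnihilator.

(** Put [A = X^T X]. If the r-th singular value is nonzero, [A] has rank r and the row space of [Q],
    hence it is injective on matrices fixed by [Q]. Cayley-Hamilton then gives [h(A) B = 0], where
    [h] has only the r largest eigenvalues as roots, each at least the square of the r-th singular
    value. *)
Lemma sigma_lower_bound (R : realType) m n r p (X : 'M[R]_(m, n)) (Q : 'M[R]_n)
    (B : 'M[R]_(n, p)) :
  (0 < r <= n)%N -> Q^T = Q -> \rank Q = r -> X *m Q = X -> Q *m B = B ->
  sigma r X ^+ 2 * frob B B <= frob (X *m B) (X *m B).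
Proof.
move=> /andP[r_gt0 rn]; case: n X Q B rn => [|n] X Q B rn Qt rQ XQ QB.
  by move: r_gt0; rewrite ltnNge rn.
(* This also covers the default value of [singular_values]. *)
have [->|sr0] := eqVneq (sigma r X) 0.
  by rewrite expr0n mul0r (ip_ge0 (inner_frob _ _)).
move: sr0; rewrite /sigma /singular_values; case: xgetP => [s _|_]; last first.
  by rewrite nth_nil eqxx.
case=> s_sorted s_ge0 s_char sr0.
set A := X^T *m X in s_char.
have At : A^T = A by rewrite /A trmx_mul trmxK.
have AQ : A *m Q = A by rewrite /A -mulmxA XQ.
have QA : Q *m A = A by have := congr1 trmx AQ; rewrite trmx_mul Qt At.
have s_size : size s = n.+1.
  apply/eqP; rewrite -eqSS -(size_char_poly A) s_char.
  rewrite -(big_map (fun x => x ^+ 2) xpredT (fun y => 'X - y%:P)).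
  by rewrite size_prod_XsubC size_map.
(* The r-th singular value has index [r.-1] in the nonincreasing list, so it bounds the first r
   entries from below. *)
have s_gt0 : all (fun x => s`_r.-1 <= x) (take r s).
  apply/(all_nthP 0) => i; rewrite size_takel ?s_size // => ir.
  rewrite nth_take //; apply: (sorted_leq_nth _ _ _ s_sorted); rewrite ?inE ?s_size.
  - by move=> y x z /= yx zy; exact: le_trans zy yx.
  - by move=> x /=.
  - exact: leq_trans ir rn.
  - by rewrite prednK //.
  - by rewrite -ltnS prednK //.
have sr_gt0 : 0 < s`_r.-1.
  by rewrite lt_neqAle eq_sym sr0 (allP s_ge0) // mem_nth // s_size prednK.
have take0 : count_mem 0 [seq x ^+ 2 | x <- take r s] = 0%N.
  apply/count_memPn/negP => /mapP[x /(allP s_gt0) sx /esym/eqP].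
  by rewrite sqrf_eq0 => /eqP x0; move: sr_gt0; rewrite x0 ltNge in sx *; rewrite sx.
(* The multiplicity of 0 as a root of the characteristic polynomial is the number of zeros in the
   list of squares. *)
have rankA : (n.+1 - \rank A <= count_mem 0%R [seq x ^+ 2 | x <- s])%N.
  rewrite -mu_prod_XsubC mup_geq; last first.
    by rewrite monic_neq0 // monic_prod_XsubC.
  by rewrite subr0 big_map -s_char Xn_dvd_char_poly.
have rankAQ : (\rank A <= r)%N by rewrite -rQ -AQ mxrankM_maxr.
have size_drop' : size [seq x ^+ 2 | x <- drop r s] = (n.+1 - r)%N.
  by rewrite size_map size_drop s_size.
rewrite -(cat_take_drop r s) map_cat count_cat take0 add0n in rankA.
(* The first r squares are nonzero, so all the zeros required by the nullity sit in the tail; the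
   tail has just enough room, which also forces the rank of [A] to be r. *)
have drop0 : all (pred1 0) [seq x ^+ 2 | x <- drop r s].
  rewrite all_count size_drop' eqn_leq -{1}size_drop' count_size /=.
  exact: leq_trans (leq_sub2l _ rankAQ) rankA.
have rankA_r : \rank A = r.
  have := leq_trans rankA (count_size _ _); rewrite size_drop'.
  by move: rn rankAQ; lia.
have /submxP[D QD] : (Q <= A)%MS.
  by rewrite -(mxrank_leqif_sup (_ : (A <= Q)%MS)) ?rankA_r ?rQ // -AQ submxMl.
pose h := \prod_(y <- [seq x ^+ 2 | x <- take r s]) ('X - y%:P).
have A_inj k C : Q *m C = C -> A ^+ k *m C = 0 -> C = 0 :> 'M[R]_(n.+1, p).
  elim: k C => [|k IH] C QC; first by rewrite expr0 mul1mx.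
  rewrite exprSr -mulmxE -mulmxA => AC.
  have AC0 : A *m C = 0 by apply: IH => //; rewrite mulmxA QA.
  by rewrite -QC QD -mulmxA AC0 mulmx0.
have charE : char_poly A = 'X^(n.+1 - r) * h.
  rewrite s_char -(big_map (fun x => x ^+ 2) xpredT (fun y => 'X - y%:P)).
  rewrite -(cat_take_drop r s) map_cat big_cat /= mulrC; congr (_ * _).
    rewrite (eq_big_seq (fun=> 'X)) => [|y /(allP drop0)/eqP ->]; last first.
      by rewrite subr0.
    by rewrite big_const_seq count_predT size_drop' iter_mulr_1.
have hB : horner_mx A h *m B = 0.
  (* [h(A) B] is fixed by [Q] because [A] commutes with [Q]; the power of [A] in Cayley-Hamilton can
     therefore be cancelled. *)
  apply: (A_inj (n.+1 - r)%N).
    have AQC : comm_mx A Q by rewrite /comm_mx AQ QA.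
    by rewrite mulmxA -(comm_horner_mx h AQC) -mulmxA QB.
  have := Cayley_Hamilton A; rewrite charE rmorphM rmorphXn /= horner_mx_X => CH.
  by rewrite mulmxA mulmxE CH mul0mx.
have := sym_annihilated_lower_bound At _ hB.
rewrite /A -mulmxA frob_mull trmxK; apply => _ /mapP[x /(allP s_gt0) sx ->].
by rewrite ler_pXn2r ?nnegrE ?(ltW sr_gt0) ?(le_trans (ltW sr_gt0)).
Qed.

(** * Curves of matrices *)

Section IsDerive.
Context (R : realType) (V : normedModType R).
Implicit Types (x v : V).

Lemma is_deriveP (W : normedModType R) (f : V -> W) x v d :
  is_derive x v f d <->
  h^-1 *: ((f \o shift x) (h *: v) - f x) @[h --> 0^'] --> d.
Proof.
split=> [[fx <-] //|fd]; apply: DeriveDef; first by apply/cvg_ex; exists d.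
exact: cvg_lim.
Qed.

Lemma is_derive_pairP (W1 W2 : normedModType R) (f : V -> W1 * W2) x v d :
  is_derive x v f d <->
  is_derive x v (fun y => (f y).1) d.1 /\ is_derive x v (fun y => (f y).2) d.2.
Proof.
rewrite !is_deriveP; split=> [fd|[f1 f2]].
  split.
    apply: (@cvg_comp _ _ _ _ fst _ _ _ fd).
    by case: d {fd} => d1 d2; exact: cvg_fst.
  apply: (@cvg_comp _ _ _ _ snd _ _ _ fd).
  by case: d {fd} => d1 d2; exact: cvg_snd.
case: d => d1 d2 in f1 f2 *; exact: (cvg_pair f1 f2).
Qed.

Lemma is_derive_mxP m n (M : V -> 'M[R]_(m, n)) x v D :
  is_derive x v M D <-> forall i j, is_derive x v (fun y => M y i j) (D i j).
Proof.
split=> [[Mx <-] i j|MD].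
  rewrite derive_mx // mxE; apply: DeriveDef => //.
  by move/derivable_mxP : Mx.
have Mx : derivable M x v by apply/derivable_mxP => i j; case: (MD i j).
apply: DeriveDef => //; rewrite derive_mx //; apply/matrixP => i j.
by rewrite mxE; case: (MD i j).
Qed.

Lemma is_derive_trmx m n (A : V -> 'M[R]_(m, n)) x v dA :
  is_derive x v A dA -> is_derive x v (fun y => (A y)^T) dA^T.
Proof.
move=> /is_derive_mxP AD; apply/is_derive_mxP => i j; rewrite mxE.
by under eq_fun do rewrite mxE; exact: AD.
Qed.

Lemma is_derive_mulmx m n p (A : V -> 'M[R]_(m, n)) (B : V -> 'M[R]_(n, p))
    x v dA dB :
  is_derive x v A dA -> is_derive x v B dB ->
  is_derive x v (fun y => A y *m B y) (dA *m B x + A x *m dB).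
Proof.
move=> /is_derive_mxP AD /is_derive_mxP BD; apply/is_derive_mxP => i j.
have -> : (fun y => (A y *m B y) i j) =
    \sum_k ((fun y => A y i k) * (fun y => B y k j)).
  by apply/funext => y; rewrite mxE fct_sumE.
rewrite !mxE -big_split; apply: is_derive_sum => k.
apply: is_derive_eq.
by rewrite /= addrC /GRing.scale /= [B x k j * _]mulrC.
Qed.

Lemma is_derive_frob m n (A B : V -> 'M[R]_(m, n)) x v dA dB :
  is_derive x v A dA -> is_derive x v B dB ->
  is_derive x v (fun y => frob (A y) (B y)) (frob dA (B x) + frob (A x) dB).
Proof.
move=> AD BD; have := is_derive_mulmx (is_derive_trmx AD) BD.
move=> /is_derive_mxP MD.
have -> : (fun y => frob (A y) (B y)) = \sum_i (fun y => ((A y)^T *m B y) i i).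
  by apply/funext => y; rewrite fct_sumE.
rewrite /frob -mxtraceD; apply: is_derive_sum => i; exact: MD.
Qed.

Lemma is_derive_comp (W1 W2 : normedModType R) (f : W1 -> W2) (c : R -> W1) t d :
  differentiable f (c t) -> is_derive t 1 c d ->
  is_derive t 1 (fun s => f (c s)) ('D_d f (c t)).
Proof.
move=> df [/derivable1_diffP dc <-].
have dfc : differentiable (f \o c) t by exact: differentiable_comp.
apply: DeriveDef; first exact/derivable1_diffP.
by rewrite deriveE // diff_comp //= -(deriveE _ dc) -deriveE.
Qed.

End IsDerive.

(** * Algebras of real functions and matrices with entries in them *)

Section FunctionAlgebra.
Context (R : realType) (S : (R -> R) -> Prop).

(* Used both for rational functions (smooth curves) and for functions derivable
   at a given point (the gradient field along a curve). *)
Definition function_algebra :=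
  [/\ forall a, S (cst a), forall f g, S f -> S g -> S (f + g),
      forall f g, S f -> S g -> S (f * g)
    & forall f, S f -> (forall t, f t != 0) -> S (fun t => (f t)^-1)].

Definition entries_in m n (A : R -> 'M[R]_(m, n)) :=
  forall i j, S (fun t => A t i j).

Hypothesis algS : function_algebra.

Lemma function_algebra_sum I (r : seq I) (P : pred I) (F : I -> R -> R) :
  (forall i, P i -> S (F i)) -> S (\sum_(i <- r | P i) F i).
Proof.
by case: algS => S0 SD _ _ SF; apply: (big_ind S) => //; exact: S0.
Qed.

Lemma function_algebra_prod I (r : seq I) (P : pred I) (F : I -> R -> R) :
  (forall i, P i -> S (F i)) -> S (fun t => \prod_(i <- r | P i) F i t).
Proof.
case: algS => S0 _ SM _ SF; elim: r => [|i r IH].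
  rewrite (_ : (fun _ => _) = cst 1) //.
  by apply/funext => t; rewrite big_nil.
pose G t := \prod_(j <- r | P j) F j t.
rewrite (_ : (fun _ => _) = if P i then F i * G else G).
  by case: ifP => // Pi; exact: SM (SF i Pi) IH.
by apply/funext => t; rewrite big_cons; case: ifP.
Qed.

Lemma entries_in_cst m n (A : 'M[R]_(m, n)) : entries_in (fun=> A).
Proof. by case: algS => S0 _ _ _ i j; exact: S0. Qed.

Lemma entries_in_add m n (A B : R -> 'M[R]_(m, n)) :
  entries_in A -> entries_in B -> entries_in (fun t => A t + B t).
Proof.
move=> SA SB i j; case: algS => _ SD _ _.
rewrite (_ : (fun _ => _) = (fun t => A t i j) + (fun t => B t i j)); last first.
  by apply/funext => t; rewrite mxE.
exact: SD.
Qed.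

Lemma entries_in_scale m n f (A : R -> 'M[R]_(m, n)) :
  S f -> entries_in A -> entries_in (fun t => f t *: A t).
Proof.
move=> Sf SA i j; case: algS => _ _ SM _.
rewrite (_ : (fun _ => _) = f * (fun t => A t i j)); last first.
  by apply/funext => t; rewrite mxE.
exact: SM.
Qed.

Lemma entries_in_tr m n (A : R -> 'M[R]_(m, n)) :
  entries_in A -> entries_in (fun t => (A t)^T).
Proof.
move=> SA i j; rewrite (_ : (fun _ => _) = (fun t => A t j i)) //.
by apply/funext => t; rewrite mxE.
Qed.

Lemma entries_in_mulmx m n p (A : R -> 'M[R]_(m, n)) (B : R -> 'M[R]_(n, p)) :
  entries_in A -> entries_in B -> entries_in (fun t => A t *m B t).
Proof.
move=> SA SB i j.
have -> : (fun t => (A t *m B t) i j) =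
    \sum_k ((fun t => A t i k) * (fun t => B t k j)).
  by apply/funext => t; rewrite mxE fct_sumE.
by case: algS => _ _ SM _; apply: function_algebra_sum => k _; exact: SM.
Qed.

Lemma function_algebra_det n (A : R -> 'M[R]_n) :
  entries_in A -> S (fun t => \det (A t)).
Proof.
move=> SA; case: algS => S0 _ SM _.
have -> : (fun t => \det (A t)) =
    \sum_(s : 'S_n) (cst ((-1) ^+ s) * (fun t => \prod_i A t i (s i))).
  by apply/funext => t; rewrite fct_sumE.
apply: function_algebra_sum => s _; apply: SM => //.
by apply: function_algebra_prod => i _; exact: SA.
Qed.

(** Cramer's rule: each entry is a cofactor divided by the determinant, which vanishes nowhere. *)
Lemma entries_in_invmx n (A : R -> 'M[R]_n) :
  (forall t, A t \in unitmx) -> entries_in A -> entries_in (fun t => invmx (A t)).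
Proof.
move=> uA SA i j; case: algS => S0 _ SM SV.
rewrite (_ : (fun _ => _) = (fun t => (\det (A t))^-1) *
    (cst ((-1) ^+ (j + i)) * (fun t => \det (row' j (col' i (A t)))))); last first.
  by apply/funext => t; rewrite /invmx uA !mxE.
apply/SM.
  apply: SV (function_algebra_det SA) _ => t.
  by move: (uA t); rewrite unitmxE unitfE.
apply: SM => //; apply: function_algebra_det => k l.
rewrite (_ : (fun _ => _) = (fun t => A t (lift j k) (lift i l))) //.
by apply/funext => t; rewrite !mxE.
Qed.

End FunctionAlgebra.

(** * Rational functions of one real variable and their smoothness *)

Section RationalFunctions.
Context (R : realType).

Lemma function_algebra_derivable (t : R) :
  function_algebra (fun f : R -> R => derivable f t 1).
Proof.
split=> [a|f g|f g|f df f0].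
- exact: derivable_cst.
- exact: derivableD.
- exact: derivableM.
- exact: derivableV.
Qed.

Lemma entries_derivable m n (A : R -> 'M[R]_(m, n)) t :
  entries_in (fun f : R -> R => derivable f t 1) A <-> derivable A t 1.
Proof. by rewrite derivable_mxP. Qed.

(** Denominators without real roots make the class closed under differentiation on the whole line,
    so membership yields smoothness of every order. *)
Definition rational (f : R -> R) := exists p q : {poly R},
  (forall t, q.[t] != 0) /\ f = (fun t => p.[t] / q.[t]).

Lemma rational_poly (p : {poly R}) : rational (horner p).
Proof.
exists p, 1; split=> [t|]; first by rewrite hornerC oner_neq0.
by apply/funext => t; rewrite hornerC divr1.
Qed.

Lemma function_algebra_rational : function_algebra rational.
Proof.
split=> [a|_ _ [p [q [q0 ->]]] [p' [q' [q'0 ->]]]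
  |_ _ [p [q [q0 ->]]] [p' [q' [q'0 ->]]]|].
- by rewrite -hornerC_ext; exact: rational_poly.
- exists (p * q' + p' * q), (q * q'); split=> [t|].
    by rewrite hornerM mulf_neq0.
  by apply/funext => t; rewrite !hornerE -addf_div.
- exists (p * p'), (q * q'); split=> [t|]; first by rewrite hornerM mulf_neq0.
  by apply/funext => t; rewrite !hornerM -mulf_div.
- move=> _ [p [q [q0 ->]]] pq0; exists q, p; split=> [t|].
    by have := pq0 t; rewrite mulf_eq0 negb_or => /andP[].
  by apply/funext => t; rewrite invf_div.
Qed.

Lemma rational_derive f : rational f ->
  exists2 f', rational f' & forall t, is_derive (t : R) 1 f (f' t).
Proof.
move=> [p [q [q0 ->]]]; exists (fun t => (p^`() * q - p * q^`()).[t] / (q * q).[t]).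
  exists (p^`() * q - p * q^`()), (q * q); split=> // t.
  by rewrite hornerM mulf_neq0.
move=> t; have dq : derivable (horner q) t 1 by exact: derivable_horner.
have dp : derivable (horner p) t 1 by exact: derivable_horner.
have dqV : derivable (fun y => q.[y]^-1) t 1 by apply: derivableV.
have -> : (fun t => p.[t] / q.[t]) = horner p * (fun t => q.[t]^-1) by [].
apply: DeriveDef; first exact: derivableM.
rewrite deriveM // deriveV // !derive_val.
rewrite -[LHS]/(p.[t] * (- q.[t] ^- 2 * q^`().[t]) + q.[t]^-1 * p^`().[t]).
rewrite !(hornerM, hornerD, hornerN); field; exact: q0.
Qed.

Lemma entries_rational_derive m n (A : R -> 'M[R]_(m, n)) :
  entries_in rational A ->
  exists2 A', entries_in rational A' & forall t, is_derive (t : R) 1 A (A' t).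
Proof.
move=> SA; have /= A' i j := cid2 (rational_derive (SA i j)).
exists (fun t => \matrix_(i, j) s2val (A' i j) t) => [i j|t].
  rewrite (_ : (fun _ => _) = s2val (A' i j)); first by case: (A' i j).
  by apply/funext => t; rewrite mxE.
by apply/is_derive_mxP => i j; rewrite mxE; case: (A' i j).
Qed.

Lemma rational_pair_smooth m n p q (A : R -> 'M[R]_(m, n)) (B : R -> 'M[R]_(p, q))
    k t : entries_in rational A -> entries_in rational B ->
  derivable (derive1n k (fun t => (A t, B t))) t 1.
Proof.
elim: k A B => [|k IH] A B SA SB.
  have [A' _ AD] := entries_rational_derive SA.
  have [B' _ BD] := entries_rational_derive SB.
  have [//] : is_derive t 1 (fun t => (A t, B t)) (A' t, B' t).
  by apply/is_derive_pairP; split; [exact: AD|exact: BD].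
have [A' SA' AD] := entries_rational_derive SA.
have [B' SB' BD] := entries_rational_derive SB.
rewrite derive1Sn (_ : derive1 _ = fun t => (A' t, B' t)); first exact: IH.
apply/funext => s; rewrite derive1E.
have [_ ->] // : is_derive s 1 (fun t => (A t, B t)) (A' s, B' s).
by apply/is_derive_pairP; split; [exact: AD|exact: BD].
Qed.

End RationalFunctions.

(** * Tangent spaces and gradients *)

Lemma is_derive_unique (R : realType) (V W : normedModType R) (f : V -> W)
    x v a b :
  is_derive x v f a -> is_derive x v f b -> a = b.
Proof. by move=> [_ <-] [_ <-]. Qed.

Lemma smooth_curve_near (R : realType) (V : normedModType R) (M : set V) c :
  smooth_curve M c -> \forall t \near (0 : R), M (c t).
Proof.
move=> [e e0 Mc]; apply: filterS (nbhs0_lt e0) => t te.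
by have [] := Mc t te.
Qed.

Lemma curve_through_is_derive (R : realType) (V : normedModType R) (M : set V)
    p v c : curve_through M p v c -> is_derive (0 : R) 1 c v.
Proof.
move=> [[e e0 Mc] _ <-]; rewrite derive1E; apply: DeriveDef => //.
by have [|_ /(_ 0)] := Mc 0; first by rewrite normr0.
Qed.

Section Desingularization.
Context (R : realType) (m n r : nat).
Implicit Types (X Y K L : 'M[R]_(m, n)) (P S B C E : 'M[R]_n).

Local Notation M := (@desing R m n r).

(** For a symmetric projector [P], the matrix [C] is a block mapping the range of [P] into its
    kernel, and [K] lives on that kernel. These are free coordinates for the tangent space at
    [(X, P)]. *)
Definition horizontal_pair P K C := [/\ K *m P = 0, P *m C = 0 & C *m P = C].

Definition tangent_vector X K C : 'M[R]_(m, n) * 'M[R]_n :=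
  (K - X *m C, C + C^T).

Lemma horizontal_pair_tr P K C : P^T = P -> horizontal_pair P K C ->
  C^T *m P = 0 /\ P *m C^T = C^T.
Proof.
move=> Pt [_ PC CP]; rewrite -[P in _ *m P]Pt -trmx_mul PC trmx0.
by rewrite -[P in P *m _]Pt -trmx_mul CP.
Qed.

(** Differentiating [P^T = P], [P P = P] and [X P = 0] along a curve gives [Z^T = Z],
    [Z P + P Z = Z] and [V P + X Z = 0]. Hence [P Z P = 0], so [Z] is determined by its block
    [C = (1 - P) Z P], and [V P = - X C]. *)
Lemma tangent_desing_sub X P v : M (X, P) -> tangent M (X, P) v ->
  exists K C, horizontal_pair P K C /\ v = tangent_vector X K C.
Proof.
move=> [/= [Pt PP _] XP] [c cv]; have cD := curve_through_is_derive cv.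
case: cv => c_smooth c0 _; case: v cD => V Z /is_derive_pairP[/= XD PD].
have Mc := smooth_curve_near c_smooth.
have Zt : Z^T = Z.
  apply: is_derive_unique (is_derive_trmx PD) _.
  by apply: near_eq_is_derive PD; apply: filterS Mc => t [[]].
have ZP : Z *m P + P *m Z = Z.
  have := is_derive_mulmx PD PD; rewrite c0 /= => H.
  apply: is_derive_unique H _; apply: near_eq_is_derive PD.
  by apply: filterS Mc => t [[]].
have VP : V *m P + X *m Z = 0.
  have := is_derive_mulmx XD PD; rewrite c0 /= => H.
  apply: is_derive_unique H _; apply: near_eq_is_derive (is_derive_cst 0 _ _).
  by apply: filterS Mc => t [].
have PZP : P *m Z *m P = 0.
  have := congr1 (mulmx P) ZP; rewrite mulmxDr !mulmxA PP.
  by move/(canRL (addrK _)); rewrite subrr.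
have XQ : X *m (1%:M - P) = X by rewrite mulmxBr mulmx1 XP subr0.
have XZP : X *m Z *m P = X *m Z.
  by rewrite -[in RHS]ZP mulmxDr !mulmxA XP mul0mx addr0.
exists (V *m (1%:M - P)), ((1%:M - P) *m Z *m P); split; first split.
- by rewrite -mulmxA mulmxBl mul1mx PP subrr mulmx0.
- by rewrite !mulmxA mulmxBr mulmx1 PP subrr !mul0mx.
- by rewrite -mulmxA PP.
congr (_, _).
  rewrite !mulmxA XQ XZP mulmxBr mulmx1 (_ : V *m P = - (X *m Z)).
    by rewrite opprK addrK.
  by apply/eqP; rewrite -addr_eq0 VP.
rewrite !trmx_mul linearB /= trmx1 Pt Zt !(mulmxBl, mulmxBr) !mul1mx !mulmx1.
by rewrite !mulmxA PZP !subr0 ZP.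
Qed.

(** A matrix [K] killed by [1 - G] satisfies [K = K G], and skewness of [G] turns the squared norm
    of [K] into its own opposite. *)
Lemma skew_unit (G : 'M[R]_n) : G^T = - G -> 1%:M - G \in unitmx.
Proof.
move=> Gt; rewrite -row_free_unit -kermx_eq0; apply/eqP.
have := mulmx_ker (1%:M - G); set K := kermx _.
rewrite mulmxBr mulmx1 => /eqP; rewrite subr_eq0 => /eqP KG.
apply: (ip_eq0 (inner_frob _ _)).
have : frob K K = - frob K K.
  rewrite {1}KG frob_mulr Gt mulmxN -KG.
  by rewrite (ipNr (inner_frob _ _)).
lra.
Qed.

Lemma is_derive_affine p q (A B : 'M[R]_(p, q)) (t : R) :
  is_derive t 1 (fun s => A + s *: B) B.
Proof.
apply/is_derive_mxP => i j.
rewrite (_ : (fun _ => _) = cst (A i j) + B i j \*: id).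
  by apply: is_derive_eq; rewrite add0r [_ *: 1]mulr1.
by apply/funext => s; rewrite !mxE mulrC.
Qed.

Lemma rational_affine p q (A B : 'M[R]_(p, q)) :
  entries_in (@rational R) (fun s => A + s *: B).
Proof.
have alg := function_algebra_rational R.
apply: entries_in_add => //; first exact: entries_in_cst.
apply: entries_in_scale => //; last exact: entries_in_cst.
rewrite (_ : (fun t => t) = horner 'X); first exact: rational_poly.
by apply/funext => t; rewrite hornerX.
Qed.

(** The curve is [((X + t K) U^T, U P U^T)], where [U] is the Cayley transform of a skew matrix.
    Orthogonality of [U] keeps it in the manifold, and its entries are rational in t. *)
Lemma tangent_desing_sup X P K C : M (X, P) -> horizontal_pair P K C ->
  tangent M (X, P) (tangent_vector X K C).
Proof.
move=> [/= [Pt PP rP] XP] hp; have [CtP PCt] := horizontal_pair_tr Pt hp.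
case: hp => KP PC CP.
(* The factor one half compensates for the Cayley transform [(1 - t G)^-1 (1 + t G)], whose
   derivative at 0 is [2 G]. *)
pose G : 'M[R]_n := 2^-1 *: (C - C^T).
have Gt : G^T = - G by rewrite linearZ linearB /= trmxK -scalerN opprB.
pose N t : 'M[R]_n := 1%:M + t *: - G.
have Nt t : (N t)^T = 1%:M + t *: G.
  by rewrite linearD linearZ /= trmx1 linearN /= Gt opprK.
have N_unit t : N t \in unitmx.
  by rewrite /N scalerN; apply: skew_unit; rewrite linearZ /= Gt scalerN.
have NtN t : (N t)^T *m N t = N t *m (N t)^T.
  rewrite Nt /N scalerN mulmxDl !mulmxBr mulmxBl !mulmxDr !mul1mx !mulmx1.
  by rewrite addrA subrK opprD addrA addrK.
pose U t := invmx (N t) *m (N t)^T.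
have UtU t : (U t)^T *m U t = 1%:M.
  apply: mulmx1C; rewrite trmx_mul trmxK trmx_inv mulmxA.
  rewrite -(mulmxA _ _ (N t)) NtN (mulmxA (invmx _)) mulVmx // mul1mx.
  by rewrite mulmxV // unitmx_tr.
have alg := function_algebra_rational R.
have U_rat : entries_in (@rational R) U.
  have N_rat : entries_in (@rational R) N by exact: rational_affine.
  apply: entries_in_mulmx => //; first exact: entries_in_invmx.
  exact: entries_in_tr.
have N0 : N 0 = 1%:M by rewrite /N scale0r addr0.
have U0 : U 0 = 1%:M by rewrite /U N0 trmx1 mulmx1 invmx1.
have U'0 : is_derive (0 : R) 1 U (C - C^T).
  have [U' _ /(_ 0) UD] := entries_rational_derive U_rat.
  have ND := is_derive_affine 1%:M (- G) 0.
  have NtD := is_derive_trmx ND.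
  have NUD := is_derive_mulmx ND UD.
  (* Differentiating [N U = N^T] at 0 yields the derivative of [U] without differentiating an
     inverse. *)
  have H : - G *m U 0 + N 0 *m U' 0 = (- G)^T.
    apply: is_derive_unique NUD _; apply: near_eq_is_derive NtD.
    by apply: filterE => t; rewrite -/(N t) /U mulmxA mulmxV ?mul1mx.
  move: H; rewrite U0 N0 mul1mx mulmx1 linearN /= Gt opprK addrC => /eqP.
  rewrite subr_eq -mulr2n -scaler_nat scalerA divff ?pnatr_eq0 // scale1r => /eqP <-.
  exact: UD.
clearbody U.
pose A t := (X + t *: K) *m (U t)^T; pose B t := U t *m P *m (U t)^T.
exists (fun t => (A t, B t)).
have c0 : (A 0, B 0) = (X, P).
  by rewrite /A /B U0 scale0r addr0 trmx1 mul1mx !mulmx1.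
have cD : is_derive (0 : R) 1 (fun t => (A t, B t)) (tangent_vector X K C).
  apply/is_derive_pairP; split=> /=.
    (* The velocity is [K + X (C^T - C)], and [X C^T = X P C^T = 0]. *)
    have := is_derive_mulmx (is_derive_affine X K 0) (is_derive_trmx U'0).
    rewrite U0 trmx1 mulmx1 scale0r addr0 linearB /= trmxK mulmxBr.
    by rewrite -{1}PCt mulmxA XP mul0mx sub0r.
  have := is_derive_mulmx (is_derive_mulmx U'0 (is_derive_cst P _ _))
            (is_derive_trmx U'0).
  rewrite U0 trmx1 !mul1mx !mulmx1 linearB /= trmxK addr0.
  by rewrite mulmxBl mulmxBr CP CtP PC PCt !subr0.
split=> //; last by rewrite derive1E; case: cD.
exists 1 => // t _; split.
  have U_full : row_full (U t).
    by rewrite row_full_unit; have [_] := mulmx1_unit (UtU t).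
  have Ut_free : row_free (U t)^T.
    by rewrite row_free_unit; have [] := mulmx1_unit (UtU t).
  split; first split=> /=.
  - by rewrite /B !trmx_mul trmxK Pt mulmxA.
  - by rewrite /B !mulmxA -(mulmxA _ (U t)^T) UtU mulmx1 -(mulmxA _ P P) PP.
  - by rewrite /B mxrankMfree // (eqmxMfull _ U_full).
  rewrite /= /A /B !mulmxA -(mulmxA _ (U t)^T) UtU mulmx1 mulmxDl XP.
  by rewrite -scalemxAl KP scaler0 addr0 mul0mx.
move=> k; apply: rational_pair_smooth.
  apply: entries_in_mulmx => //; first exact: rational_affine.
  exact: entries_in_tr.
apply: entries_in_mulmx => //; last exact: entries_in_tr.
by apply: entries_in_mulmx => //; exact: entries_in_cst.
Qed.

Lemma tangent_desingP X P v : M (X, P) ->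
  tangent M (X, P) v <->
  exists K C, horizontal_pair P K C /\ v = tangent_vector X K C.
Proof.
move=> Mp; split; first exact: tangent_desing_sub.
by case=> K [C [hp ->]]; exact: tangent_desing_sup.
Qed.

(** * Orthogonal projection onto the tangent space *)

Context (alpha : R) (alpha_gt0 : 0 < alpha).

Local Notation ip := (@ip_E R m n alpha).

(** This is the matrix [H] of the overview: for horizontal [C], the squared length of
    [tangent_vector X 0 C] is the inner product of [gram X *m C] with [C]. *)
Definition gram X : 'M[R]_n := (2 * alpha)%:M + X^T *m X.

Lemma frob_gram X q (B C : 'M[R]_(n, q)) :
  frob (gram X *m B) C = 2 * alpha * frob B C + frob (X *m B) (X *m C).
Proof.
rewrite mulmxDl mul_scalar_mx (ipDl (inner_frob _ _)) (ipZl (inner_frob _ _)).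
by rewrite -mulmxA frob_mull trmxK.
Qed.

(** Positive definiteness: a kernel element [K] would satisfy [2 alpha |K|^2 + |X K|^2 = 0]. *)
Lemma gram_unit X : gram X \in unitmx.
Proof.
rewrite -unitmx_tr -row_free_unit -kermx_eq0; apply/eqP.
have := mulmx_ker (gram X)^T; set K := kermx _ => /(congr1 trmx).
rewrite trmx_mul trmxK trmx0 => XK.
apply: trmx_inj; rewrite trmx0; apply: (ip_eq0 (inner_frob _ _)).
have /esym/eqP := frob_gram X K^T K^T.
rewrite XK (ip0l (inner_frob _ _)) paddr_eq0 ?mulr_ge0 ?(ltW alpha_gt0) //;
  try exact: (ip_ge0 (inner_frob _ _)).
by rewrite !mulf_eq0 pnatr_eq0 (gt_eqF alpha_gt0) => /andP[/eqP].
Qed.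

(* [proj_coord] solves the normal equations of the least-squares problem that
   defines the orthogonal projection of [(Y, S)] onto the tangent space. *)
Definition proj_coord X P Y S : 'M[R]_n :=
  invmx (gram X) *m
    (alpha *: ((1%:M - P) *m (S + S^T) *m P) - X^T *m Y *m P).

Definition tangent_proj (p u : 'M[R]_(m, n) * 'M[R]_n) :=
  tangent_vector p.1 (u.1 *m (1%:M - p.2)) (proj_coord p.1 p.2 u.1 u.2).

Lemma gram_proj_coord X P Y S : gram X *m proj_coord X P Y S =
  alpha *: ((1%:M - P) *m (S + S^T) *m P) - X^T *m Y *m P.
Proof. by rewrite mulmxA mulmxV ?mul1mx // gram_unit. Qed.

(** The delicate condition is [P C = 0]. Since [P X^T = 0], the matrices [P H] and [2 alpha P]
    agree, so [P H^-1] is a multiple of [P], which annihilates the right-hand side of the normal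
    equations. *)
Lemma proj_horizontal_pair X P Y S : M (X, P) ->
  horizontal_pair P (Y *m (1%:M - P)) (proj_coord X P Y S).
Proof.
move=> [/= [Pt PP rP] XP]; have PXt : P *m X^T = 0.
  by rewrite -[P in LHS]Pt -trmx_mul XP trmx0.
have PH : P = P *m invmx (gram X) *m (2 * alpha)%:M.
  have PH : P *m gram X = P *m (2 * alpha)%:M.
    by rewrite mulmxDr mulmxA PXt mul0mx addr0.
  rewrite -mulmxA scalar_mxC mulmxA -PH -mulmxA mulmxV ?mulmx1 //.
  exact: gram_unit.
split.
- by rewrite -mulmxA mulmxBl mul1mx PP subrr mulmx0.
- rewrite mulmxA.
  have -> : P *m invmx (gram X) = (2 * alpha)^-1 *: P.
    by rewrite {2}PH mul_mx_scalar scalerA mulVf ?scale1r // mulf_neq0 // gt_eqF.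
  rewrite -scalemxAl mulmxBr -scalemxAr !mulmxA PXt !mul0mx subr0.
  by rewrite mulmxBr mulmx1 PP subrr !mul0mx !scaler0.
- by rewrite -mulmxA mulmxBl -scalemxAl -!(mulmxA _ P P) PP.
Qed.

(** This is the adjoint of [tangent_vector X]: it isolates [K] and [C], so that each can be tested
    separately. *)
Lemma ip_tangent_vector X K C u : ip u (tangent_vector X K C) =
  frob u.1 K - frob (X^T *m u.1) C + alpha * frob (u.2 + u.2^T) C.
Proof.
rewrite /ip_E /= (ipBr (inner_frob _ _)) (ipDr (inner_frob _ _)).
by rewrite (ipDl (inner_frob _ _)) -[frob u.2 C^T]frob_tr trmxK frob_mull trmxK.
Qed.

(** Tested against [K], both sides see only [u.1 (1 - P)]; tested against [C], the equality is the
    normal equation [gram_proj_coord] paired with [C]. The mixed terms vanish because they pair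
    different blocks of [P]. *)
Lemma ip_tangent_proj X P u t : M (X, P) -> tangent M (X, P) t ->
  ip (tangent_proj (X, P) u) t = ip u t.
Proof.
move=> Mp /(tangent_desingP _ Mp)[K [C [hp ->]]].
have := proj_horizontal_pair u.1 u.2 Mp; have := gram_proj_coord X P u.1 u.2.
rewrite !ip_tangent_vector /tangent_proj /=; set B := proj_coord _ _ _ _.
move=> HB [_ PB BP]; case: (hp) => KP PC CP; case: Mp => [/= [Pt PP rP] XP].
have [CtP PCt] := horizontal_pair_tr Pt hp.
have Qt : (1%:M - P)^T = 1%:M - P by rewrite linearB /= trmx1 Pt.
have KQ : K *m (1%:M - P) = K by rewrite mulmxBr mulmx1 KP subr0.
have CQ : C *m (1%:M - P) = 0 by rewrite mulmxBr mulmx1 CP subrr.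
have QC : (1%:M - P) *m C = C by rewrite mulmxBl mul1mx PC subr0.
have XBK : frob (X *m B) K = 0.
  by rewrite -BP mulmxA frob_mulr Pt KP (ip0r (inner_frob _ _)).
have BtC : frob B^T C = 0.
  by rewrite -BP trmx_mul frob_mull trmxK PC (ip0r (inner_frob _ _)).
have := frob_gram X B C; rewrite HB (ipBl (inner_frob _ _)).
rewrite (ipZl (inner_frob _ _)) frob_mulr Pt CP frob_mull Qt QC.
rewrite [frob (_ *m P) C]frob_mulr Pt CP => HBC.
have XYQC : frob (X^T *m (u.1 *m (1%:M - P))) C = 0.
  by rewrite mulmxA frob_mulr Qt CQ (ip0r (inner_frob _ _)).
have XXB : frob (X^T *m (X *m B)) C = frob (X *m B) (X *m C).
  by rewrite frob_mull trmxK.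
have YQK : frob (u.1 *m (1%:M - P)) K = frob u.1 K by rewrite frob_mulr Qt KQ.
rewrite (ipBl (inner_frob _ _)) XBK YQK mulmxBr (ipBl (inner_frob _ _)).
rewrite XYQC XXB [(B + B^T)^T]linearD /= trmxK !(ipDl (inner_frob _ _)) BtC.
rewrite (ipDl (inner_frob _ _)) in HBC; lra.
Qed.

Lemma tangent_tangent_proj X P u : M (X, P) ->
  tangent M (X, P) (tangent_proj (X, P) u).
Proof.
by move=> Mp; apply: tangent_desing_sup => //; exact: proj_horizontal_pair.
Qed.

Lemma tangent_desingB X P u v : M (X, P) -> tangent M (X, P) u ->
  tangent M (X, P) v -> tangent M (X, P) (u - v).
Proof.
move=> Mp /(tangent_desingP _ Mp)[K [C [[KP PC CP] ->]]].
move=> /(tangent_desingP _ Mp)[L [E [[LP PE EP] ->]]].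
apply/(tangent_desingP _ Mp); exists (K - L), (C - E); split.
  by split; rewrite ?mulmxBr ?mulmxBl ?KP ?LP ?PC ?PE ?CP ?EP ?subrr.
rewrite /tangent_vector; congr (_, _) => /=.
  by rewrite mulmxBr !opprD !opprK addrACA.
by rewrite linearB opprD addrACA.
Qed.

(** * The Riemannian gradient as a projected Euclidean gradient *)

Section Gradient.
Context (f : 'M[R]_(m, n) -> R).
Hypothesis f_diff : forall X, differentiable (f : 'M[R]_(m, n) -> R^o) X.

Local Notation g := (@lift_fun R m n f).

Lemma frob_egrad X V : 'D_V f X = frob (egrad f X) V.
Proof.
have dX := f_diff X.
rewrite (deriveE _ dX) {1}(matrix_sum_delta V) linear_sum frobE.
apply: eq_bigr => i _; rewrite linear_sum; apply: eq_bigr => j _.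
by rewrite linearZ /= -deriveE // mxE mulrC.
Qed.

Definition desing_grad (p : 'M[R]_(m, n) * 'M[R]_n) :=
  tangent_proj p (egrad f p.1, 0).

Lemma is_riem_grad_desing_grad p : M p -> is_riem_grad ip M g p (desing_grad p).
Proof.
case: p => X P Mp; split=> [|v c cv]; first exact: tangent_tangent_proj.
have Tv : tangent M (X, P) v by exists c.
rewrite ip_tangent_proj // /ip_E /= (ip0l (inner_frob _ _)) mulr0 addr0.
rewrite -frob_egrad; case: (cv) => _ c0 _.
have /is_derive_pairP[cD _] := curve_through_is_derive cv.
have -> : X = (c 0).1 by rewrite c0.
exact: (is_derive_comp (f_diff _) cD).
Qed.

(** Two gradients differ by a tangent vector; along a curve with that velocity both represent the
    same derivative, so the difference is orthogonal to itself. *)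
Lemma riem_grad_desing p : M p -> riem_grad ip M g p = desing_grad p.
Proof.
move=> Mp; have [TG GD] := is_riem_grad_desing_grad Mp.
apply: xget_unique => // H [TH HD]; apply/eqP; rewrite -subr_eq0; apply/eqP.
apply: (ip_eq0 (inner_ip_E m n alpha_gt0)).
have [c cD] : tangent M p (H - desing_grad p).
  by case: p Mp TG {GD} TH {HD} => X P Mp TG TH; exact: tangent_desingB.
rewrite (ipBl (inner_ip_E m n alpha_gt0)).
by rewrite (is_derive_unique (HD _ _ cD) (GD _ _ cD)) subrr.
Qed.

End Gradient.

End Desingularization.

(** * The Riemannian Hessian *)

Section Hessian.
Context (R : realType) (m n r : nat).
Implicit Types (X Y K L : 'M[R]_(m, n)) (P S B C E : 'M[R]_n).

Local Notation M := (@desing R m n r).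

Lemma desing_rank_compl X P : (r <= n)%N -> M (X, P) -> \rank (1%:M - P) = r.
Proof.
move=> rn [/= [_ PP rP] _].
have -> : \rank (1%:M - P) = \rank (kermx P).
  apply/eqP; rewrite eqn_leq; apply/andP; split; apply: mxrankS.
    by apply/sub_kermxP; rewrite mulmxBl mul1mx PP subrr.
  apply/submxP; exists (kermx P).
  by rewrite mulmxBr mulmx1 mulmx_ker subr0.
by rewrite mxrank_ker rP subKn.
Qed.

(** This places the base point in the neighborhood where [f] is twice continuously
    differentiable. *)
Lemma desing_rank X P : (r <= n)%N -> M (X, P) -> (\rank X <= r)%N.
Proof.
move=> rn Mp; rewrite -(desing_rank_compl rn Mp); case: Mp => /= _ XP.
have {1}-> : X = X *m (1%:M - P) by rewrite mulmxBr mulmx1 XP subr0.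
exact: mxrankM_maxr.
Qed.

Context (alpha : R) (alpha_gt0 : 0 < alpha) (f : 'M[R]_(m, n) -> R).
Hypothesis f_diff : forall X, differentiable (f : 'M[R]_(m, n) -> R^o) X.

Local Notation ip := (@ip_E R m n alpha).
Local Notation g := (@lift_fun R m n f).
Local Notation grad := (@desing_grad R m n alpha f).

Lemma is_derive_ip (A B : R -> 'M[R]_(m, n) * 'M[R]_n) (t : R) dA dB :
  is_derive t 1 A dA -> is_derive t 1 B dB ->
  is_derive t 1 (fun s => ip (A s) (B s)) (ip dA (B t) + ip (A t) dB).
Proof.
move=> /is_derive_pairP[A1 A2] /is_derive_pairP[B1 B2].
have D1 := is_derive_frob A1 B1; have D2 := is_derive_frob A2 B2.
have D := is_deriveD D1 (is_deriveZ alpha D2).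
rewrite /ip_E (_ : _ + _ = frob dA.1 (B t).1 + frob (A t).1 dB.1 +
  alpha *: (frob dA.2 (B t).2 + frob (A t).2 dB.2)); first exact: D.
by rewrite /GRing.scale /=; ring.
Qed.

(** The projection uses only ring operations and the inverse of [gram], which is invertible
    everywhere. Taking for [S] the functions derivable at a point gives derivability of the gradient
    field along curves. *)
Lemma entries_in_tangent_proj (S : (R -> R) -> Prop)
    (c : R -> 'M[R]_(m, n) * 'M[R]_n) (Y : R -> 'M[R]_(m, n)) :
  function_algebra S -> entries_in S (fun t => (c t).1) ->
  entries_in S (fun t => (c t).2) -> entries_in S Y ->
  entries_in S (fun t => (tangent_proj alpha (c t) (Y t, 0)).1) /\
  entries_in S (fun t => (tangent_proj alpha (c t) (Y t, 0)).2).
Proof.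
move=> alg SX SP SY; have Scst : forall a, S (cst a) by case: alg.
have SB p q (A B : R -> 'M[R]_(p, q)) :
    entries_in S A -> entries_in S B -> entries_in S (fun t => A t - B t).
  move=> SA SB; apply: entries_in_add => //.
  rewrite (_ : (fun t => _) = fun t => -1 *: B t).
    exact: (entries_in_scale alg (f := cst (-1))).
  by apply/funext => t; rewrite scaleN1r.
have SQ : entries_in S (fun t => 1%:M - (c t).2).
  by apply: (SB) => //; exact: entries_in_cst.
have SXt : entries_in S (fun t => (c t).1^T) by exact: entries_in_tr.
have SC : entries_in S (fun t => proj_coord alpha (c t).1 (c t).2 (Y t) 0).
  apply: entries_in_mulmx => //.
    apply: entries_in_invmx => // [t|]; first exact: gram_unit.
    apply: entries_in_add => //; first exact: entries_in_cst.
    exact: entries_in_mulmx.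
  apply: (SB); last by apply: entries_in_mulmx => //; exact: entries_in_mulmx.
  apply: (entries_in_scale alg (f := cst alpha)) => //.
  apply: entries_in_mulmx => //; apply: entries_in_mulmx => //.
  exact: entries_in_cst.
split; last by apply: entries_in_add => //; exact: entries_in_tr.
by apply: SB => //; exact: entries_in_mulmx.
Qed.

Lemma derivable_desing_grad (c : R -> 'M[R]_(m, n) * 'M[R]_n) (t : R) :
  derivable c t 1 -> differentiable (egrad f) (c t).1 ->
  derivable (grad \o c) t 1.
Proof.
move=> /derivableP; set v := 'D_1 c t => /is_derive_pairP[XD PD] fD.
have YD := is_derive_comp fD XD.
have [||| G1 G2] := entries_in_tangent_proj (function_algebra_derivable t)
  (c := c) (Y := fun s => egrad f (c s).1).
- by apply/entries_derivable; case: XD.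
- by apply/entries_derivable; case: PD.
- by apply/entries_derivable; case: YD.
have [] // : is_derive t 1 (grad \o c)
  ('D_1 (fun s => (grad (c s)).1) t, 'D_1 (fun s => (grad (c s)).2) t).
by apply/is_derive_pairP; split; apply: derivableP; apply/entries_derivable.
Qed.

(* The first component of the part of [(egrad f X, 0)] normal to [M]. *)
Definition normal_grad X P :=
  egrad f X *m P + X *m proj_coord alpha X P (egrad f X) 0.

(** Extend the test vector to a tangent field [u] along [c] and differentiate the identity between
    [ip grad u] and [frob egrad u.1]. The derivative of [u] is paired only with the normal part of
    the gradient, which produces the curvature term. *)
Lemma ip_derive_desing_grad X P K C L E c D : M (X, P) ->
  differentiable (egrad f) X ->
  horizontal_pair P K C -> horizontal_pair P L E ->
  curve_through M (X, P) (tangent_vector X L E) c ->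
  is_derive (0 : R) 1 (grad \o c) D ->
  ip D (tangent_vector X K C) =
  frob (ehess f X (L - X *m E)) (K - X *m C)
  - frob (normal_grad X P) (K *m E + L *m C).
Proof.
move=> Mp fD hKC hLE cv GD; have /is_derive_pairP[/= XD PD] :=
  curve_through_is_derive cv.
case: (cv) => c_smooth c0 _; have Mc := smooth_curve_near c_smooth.
have [/= [Pt PP rP] XP] := Mp.
have [CtP PCt] := horizontal_pair_tr Pt hKC.
have [EtP PEt] := horizontal_pair_tr Pt hLE.
case: (hKC) (hLE) => [KP PC CP] [LP PE EP].
have EC : E *m C = 0 by rewrite -EP -mulmxA PC mulmx0.
have CE : C *m E = 0 by rewrite -CP -mulmxA PE mulmx0.
have KEt : K *m E^T = 0 by rewrite -PEt mulmxA KP mul0mx.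
have XEt : X *m E^T = 0 by rewrite -PEt mulmxA XP mul0mx.
have QC : (1%:M - P) *m C = C by rewrite mulmxBl mul1mx PC subr0.
have QD : is_derive (0 : R) 1 (fun t => 1%:M - (c t).2) (- (E + E^T)).
  have := is_deriveB (is_derive_cst 1%:M (0 : R) 1) PD; rewrite sub0r; exact.
(* Projecting the fixed [K] and [C] with the moving projector keeps the pair horizontal along the
   curve. *)
pose Kt t := K *m (1%:M - (c t).2).
pose Ct t := (1%:M - (c t).2) *m C *m (c t).2.
have KD : is_derive (0 : R) 1 Kt (- (K *m E)).
  have := is_derive_mulmx (is_derive_cst K (0 : R) 1) QD.
  by rewrite mul0mx add0r mulmxN mulmxDr KEt addr0.
pose C' := C *m E^T - E^T *m C.
have CD : is_derive (0 : R) 1 Ct C'.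
  have := is_derive_mulmx (is_derive_mulmx QD (is_derive_cst C (0 : R) 1)) PD.
  rewrite c0 /= mulmx0 addr0 QC -mulmxA CP mulNmx mulmxDl EC add0r.
  by rewrite mulmxDr CE add0r addrC.
have Ct0 : Ct 0 = C by rewrite /Ct c0 /= QC CP.
pose u t := tangent_vector (c t).1 (Kt t) (Ct t).
have u0 : u 0 = tangent_vector X K C.
  by rewrite /u Ct0 /Kt c0 /= mulmxBr mulmx1 KP subr0.
have uD : is_derive (0 : R) 1 u
    (- (K *m E) - (L *m C + X *m C'), C' + C'^T).
  apply/is_derive_pairP; split=> /=; last first.
    exact: is_deriveD CD (is_derive_trmx CD).
  have := is_deriveB KD (is_derive_mulmx XD CD).
  by rewrite Ct0 mulmxBl -(mulmxA X) EC mulmx0 subr0 c0.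
have Mu t : M (c t) -> horizontal_pair (c t).2 (Kt t) (Ct t).
  move=> [[_ PPt _] _]; split.
  - by rewrite /Kt -mulmxA mulmxBl mul1mx PPt subrr mulmx0.
  - by rewrite /Ct !mulmxA mulmxBr mulmx1 PPt subrr !mul0mx.
  - by rewrite /Ct -(mulmxA _ (c t).2 (c t).2) PPt.
have := is_derive_ip GD uD; rewrite u0 /= c0 => ipD.
have YD : is_derive (0 : R) 1 (fun t => egrad f (c t).1) (ehess f X (L - X *m E)).
  have -> : ehess f X = ehess f (c 0).1 by rewrite c0.
  by apply: is_derive_comp XD; rewrite c0.
have [u1D _] := (is_derive_pairP _ _ _ _).1 uD.
have YuD := is_derive_frob YD u1D; rewrite u0 c0 /= in YuD.
have ip_u : \forall t \near (0 : R),
    frob (egrad f (c t).1) (u t).1 = ip ((grad \o c) t) (u t).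
  apply: filterS Mc => t; rewrite /= /u.
  case: (c t) (Mu t) => Xt Qt hu Mt.
  rewrite (ip_tangent_proj alpha_gt0 _ Mt); last first.
    exact: (tangent_desing_sup Mt (hu Mt)).
  by rewrite /ip_E /= (ip0l (inner_frob _ _)) mulr0 addr0.
have := is_derive_unique ipD (near_eq_is_derive ip_u YuD).
move/(canRL (addrK _)) => ->; rewrite -addrA; congr (_ + _).
rewrite [ip (grad _) _](ipC (inner_ip_E m n alpha_gt0)) ip_tangent_vector /=.
have := proj_horizontal_pair alpha_gt0 (egrad f X) 0 Mp.
rewrite /normal_grad; set B := proj_coord _ _ _ _ _ => -[_ PB BP]; clearbody B.
have BtP : B^T *m P = 0 by rewrite -[P in LHS]Pt -trmx_mul PB trmx0.
have BE : B *m E = 0 by rewrite -BP -mulmxA PE mulmx0.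
have EB : E *m B = 0 by rewrite -EP -mulmxA PB mulmx0.
(* [C'] is block diagonal with respect to [P], while [B] is off-diagonal; hence [C'] and its
   transpose are orthogonal to [B]. *)
have C'B : frob C' B = 0.
  rewrite (ipBl (inner_frob _ _)) frob_mulr trmxK BE frob_mull trmxK EB.
  by rewrite !(ip0r (inner_frob _ _)) subr0.
have PBt : P *m B^T = B^T by rewrite -[P]Pt -trmx_mul BP.
have C'Bt : frob C'^T B = 0.
  rewrite -frob_tr trmxK (ipBl (inner_frob _ _)).
  have -> : frob (C *m E^T) B^T = 0.
    rewrite -PBt (ipC (inner_frob _ _)) frob_mull Pt mulmxA PC mul0mx.
    exact: (ip0r (inner_frob _ _)).
  rewrite -CP mulmxA frob_mulr Pt BtP.
  by rewrite (ip0r (inner_frob _ _)) subr0.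
have NP : (egrad f X *m P + X *m B) *m P = egrad f X *m P + X *m B.
  by rewrite mulmxDl -(mulmxA _ P P) PP -(mulmxA X) BP.
(* The normal part is fixed by right multiplication by [P], whereas [X C' P = 0]. *)
have NXC' : frob (egrad f X *m P + X *m B) (X *m C') = 0.
  rewrite -NP frob_mulr Pt (_ : X *m C' *m P = 0) ?(ip0r (inner_frob _ _)) //.
  rewrite mulmxBr mulmxBl !mulmxA XEt !mul0mx subr0.
  by rewrite -(mulmxA _ E^T) EtP mulmx0.
clearbody C'.
have -> : frob (C' + C'^T + (C' + C'^T)^T) B = 0.
  by rewrite [(_ + _^T)^T]linearD /= trmxK !(ipDl (inner_frob _ _)) C'B C'Bt !addr0.
rewrite mulr0 addr0 frob_mull trmxK.
set w := - (K *m E) - (L *m C + X *m C'); set N := egrad f X *m P + X *m B.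
have Nw : frob N w = - frob N (K *m E + L *m C).
  rewrite /w opprD addrA -opprD (ipBr (inner_frob _ _)) NXC' subr0.
  exact: (ipNr (inner_frob _ _)).
clearbody w; rewrite -Nw mulmxBr mulmx1 (ipBr (inner_frob _ _)).
rewrite [frob N w](ipDl (inner_frob _ _)) [frob w (X *m B)](ipC (inner_frob _ _)).
rewrite (ipC (inner_frob _ _) w (egrad f X)).
rewrite (ipC (inner_frob _ _) w (egrad f X *m P)); ring.
Qed.

End Hessian.

(** * Estimates for the curvature term *)

Section NormBounds.
Context (R : realType) (m n r : nat).
Implicit Types (X Y K L : 'M[R]_(m, n)) (P S B C E : 'M[R]_n).

Local Notation M := (@desing R m n r).

Context (alpha : R) (alpha_gt0 : 0 < alpha) (f : 'M[R]_(m, n) -> R).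

Local Notation ip := (@ip_E R m n alpha).


(** The hypothesis says that [Z] minimizes [|W + X Z|^2 + 2 alpha |Z|^2], whose value at 0 is
    [|W|^2]. Concretely, pairing it with [Z] gives [|W + X Z|^2 = |W|^2 - |X Z|^2 - 4 alpha
    |Z|^2]. *)
Lemma frob_norm_regularized_residual_le X q (W : 'M[R]_(m, q)) (Z : 'M[R]_(n, q)) :
  gram alpha X *m Z = - (X^T *m W) -> frob_norm (W + X *m Z) <= frob_norm W.
Proof.
move=> HZ; rewrite -(@ler_pXn2r _ 2) ?nnegrE ?ip_norm_ge0 // !frob_norm_sqr.
have := frob_gram alpha X Z Z; rewrite HZ (ipNl (inner_frob _ _)).
rewrite frob_mull trmxK => WZ.
have Z0 : 0 <= 2 * alpha * frob Z Z.
  by rewrite !mulr_ge0 ?(ltW alpha_gt0) // (ip_ge0 (inner_frob _ _)).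
have XZ0 := ip_ge0 (inner_frob _ _) (X *m Z).
rewrite !(ipDl (inner_frob _ _), ipDr (inner_frob _ _)).
rewrite (ipC (inner_frob _ _) (X *m Z) W); lra.
Qed.

(** Right multiplication by [B] preserves the normal equations, so the residual estimate applies
    with [W = (egrad f X) P B]. *)
Lemma normal_grad_mulmx_le X P q (B : 'M[R]_(n, q)) :
  frob_norm (normal_grad alpha f X P *m B) <=
  spectral_norm (egrad f X *m P) * frob_norm B.
Proof.
apply: le_trans (frob_norm_mulmx_le (egrad f X *m P) B).
rewrite /normal_grad mulmxDl -mulmxA -(mulmxA X).
rewrite mulmxA; apply: frob_norm_regularized_residual_le.
rewrite mulmxA gram_proj_coord // trmx0 addr0 mulmx0 mul0mx scaler0 sub0r.
by rewrite mulNmx !mulmxA.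
Qed.

(** [X C] is orthogonal to [K], and [C] to [C^T], so the squared length is
    [|K|^2 + |X C|^2 + 2 alpha |C|^2]. The middle term is bounded by [sigma_lower_bound] for the
    complementary projector [1 - P], of rank r. *)
Lemma ip_tangent_vector_lower_bound X P K C : (0 < r)%N -> (r <= n)%N ->
  M (X, P) -> horizontal_pair P K C ->
  frob_norm K ^+ 2 + (2 * alpha + sigma r X ^+ 2) * frob_norm C ^+ 2 <=
  ip (tangent_vector X K C) (tangent_vector X K C).
Proof.
move=> r_gt0 rn Mp hKC; have rQ := desing_rank_compl rn Mp.
have [/= [Pt PP rP] XP] := Mp; have [CtP PCt] := horizontal_pair_tr Pt hKC.
case: hKC => KP PC CP; rewrite !frob_norm_sqr /ip_E /=.
have XCK : frob (X *m C) K = 0.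
  by rewrite -CP mulmxA frob_mulr Pt KP (ip0r (inner_frob _ _)).
have CCt : frob C C^T = 0.
  by rewrite -{1}CP frob_mulr Pt CtP (ip0r (inner_frob _ _)).
have := @sigma_lower_bound R m n r n X (1%:M - P) C.
rewrite r_gt0 rn linearB /= trmx1 Pt rQ mulmxBr mulmx1 XP subr0.
rewrite mulmxBl mul1mx PC subr0 => /(_ isT erefl erefl erefl erefl).
rewrite !(ipBl (inner_frob _ _), ipBr (inner_frob _ _)).
rewrite !(ipDl (inner_frob _ _), ipDr (inner_frob _ _)) frob_tr.
rewrite (ipC (inner_frob _ _) K) (ipC (inner_frob _ _) C^T) XCK CCt; lra.
Qed.

Lemma cross_term_le (k c l e s u v : R) : 0 <= k -> 0 <= c -> 0 <= l -> 0 <= e ->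
  0 < s -> 0 <= u -> 0 <= v ->
  k ^+ 2 + s * c ^+ 2 <= u ^+ 2 -> l ^+ 2 + s * e ^+ 2 <= v ^+ 2 ->
  k * e + l * c <= s `^ (- 2^-1) * (u * v).
Proof.
move=> k0 c0 l0 e0 s0 u0 v0 hu hv.
have t0 : 0 < Num.sqrt s by rewrite sqrtr_gt0.
have tt : Num.sqrt s ^+ 2 = s by rewrite sqr_sqrtr // ltW.
rewrite powRN powR12_sqrt ?(ltW s0) // [leRHS]mulrC ler_pdivlMr //.
rewrite -(@ler_pXn2r _ 2) ?nnegrE ?mulr_ge0 ?addr_ge0 ?mulr_ge0 ?(ltW t0) //.
rewrite !exprMn tt.
apply: le_trans (ler_pM _ _ hu hv);
  rewrite ?addr_ge0 ?mulr_ge0 ?sqr_ge0 ?(ltW s0) //.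
(* Lagrange's identity: the defect in Cauchy-Schwarz for [(k, sqrt s c)] and [(sqrt s e, l)] is a
   perfect square. *)
rewrite -subr_ge0 (_ : _ - _ = (k * l - s * c * e) ^+ 2) ?sqr_ge0 //; ring.
Qed.

End NormBounds.

(** * Existence of the Riemannian Hessian and its norm *)

Section HessianBound.
Context (R : realType) (m n r : nat).
Implicit Types (X Y K L : 'M[R]_(m, n)) (P S B C E : 'M[R]_n).

Local Notation M := (@desing R m n r).

Context (alpha : R) (alpha_gt0 : 0 < alpha) (f : 'M[R]_(m, n) -> R).
Hypothesis f_diff : forall X, differentiable (f : 'M[R]_(m, n) -> R^o) X.

Local Notation ip := (@ip_E R m n alpha).
Local Notation g := (@lift_fun R m n f).

(** [riem_grad] agrees with [desing_grad] only on the manifold, but [c] stays there near 0, so the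
    derivatives agree. *)
Lemma derive1_riem_grad_desing X P L E c : M (X, P) ->
  differentiable (egrad f) X -> horizontal_pair P L E ->
  curve_through M (X, P) (tangent_vector X L E) c ->
  derivable (riem_grad ip M g \o c) 0 1 /\
  forall K C, horizontal_pair P K C ->
    ip (derive1 (riem_grad ip M g \o c) 0) (tangent_vector X K C) =
    frob (ehess f X (L - X *m E)) (K - X *m C)
    - frob (normal_grad alpha f X P) (K *m E + L *m C).
Proof.
move=> Mp fD hLE cv; have cD := curve_through_is_derive cv.
have [c_smooth c0 _] := cv.
have gradE : \forall t \near (0 : R),
    (@desing_grad R m n alpha f \o c) t = (riem_grad ip M g \o c) t.
  apply: filterS (smooth_curve_near c_smooth) => t Mt.
  by rewrite /= riem_grad_desing.
have GD : is_derive (0 : R) 1 (@desing_grad R m n alpha f \o c)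
    ('D_1 (@desing_grad R m n alpha f \o c) 0).
  apply/derivableP/(derivable_desing_grad alpha_gt0); first exact: ex_derive.
  by rewrite c0.
have [ZD ZE] := near_eq_is_derive gradE GD; split=> // K C hKC.
rewrite derive1E ZE.
exact: (ip_derive_desing_grad alpha_gt0 Mp fD hKC hLE cv GD).
Qed.

(** Project the derivative along one chosen curve. The preceding formula depends on the curve only
    through its velocity, so every other curve gives the same tangential part. *)
Lemma ex_cov_deriv_desing X P v : M (X, P) -> differentiable (egrad f) X ->
  tangent M (X, P) v ->
  exists w, is_cov_deriv ip M (riem_grad ip M g) (X, P) v w.
Proof.
move=> Mp fD Tv; have [c0 c0v] := Tv.
have [L [E [hLE vE]]] := tangent_desing_sub Mp Tv; rewrite vE in c0v *.
have [_ Z0] := derive1_riem_grad_desing Mp fD hLE c0v.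
exists (tangent_proj alpha (X, P) (derive1 (riem_grad ip M g \o c0) 0)) => c cv.
have [ZD Z] := derive1_riem_grad_desing Mp fD hLE cv; split=> //.
split; first exact: tangent_tangent_proj.
move=> t Tt; have [K [C [hKC tE]]] := tangent_desing_sub Mp Tt.
rewrite (ipBl (inner_ip_E m n alpha_gt0)) (ip_tangent_proj alpha_gt0 _ Mp) //.
apply/eqP; rewrite subr_eq0 tE; apply/eqP.
exact: etrans (Z _ _ hKC) (esym (Z0 _ _ hKC)).
Qed.

Lemma riem_hess_desingP X P v : M (X, P) -> differentiable (egrad f) X ->
  tangent M (X, P) v ->
  is_cov_deriv ip M (riem_grad ip M g) (X, P) v (riem_hess ip M g (X, P) v).
Proof. by move=> Mp fD Tv; apply: xgetPex; exact: ex_cov_deriv_desing. Qed.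

(** Testing the Hessian formula against [w] itself bounds [|w|^2] by the claimed constant times
    [|v| |w|]; then divide by [|w|]. *)
Lemma riem_hess_norm_le X P v : (0 < r)%N -> (r <= n)%N ->
  M (X, P) -> differentiable (egrad f) X -> tangent M (X, P) v ->
  ip_norm ip (riem_hess ip M g (X, P) v) <=
  (op_norm setT (@frob_norm R m n) (@frob_norm R m n) (ehess f X)
    + (2 * alpha + sigma r X ^+ 2) `^ (- 2^-1)
      * spectral_norm (egrad f X *m P)) * ip_norm ip v.
Proof.
move=> r_gt0 rn Mp fD Tv; have inner := inner_ip_E m n alpha_gt0.
set s := 2 * alpha + _; set D2 := op_norm setT _ _ _; set N2 := spectral_norm _.
set w := riem_hess _ _ _ _ v.
have s_gt0 : 0 < s by rewrite ltr_pwDl ?sqr_ge0 // mulr_gt0.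
have D2_ge0 : 0 <= D2 by apply: op_norm_ge0 => ?; exact: ip_norm_ge0.
have N2_ge0 : 0 <= N2 by apply: op_norm_ge0 => ?; exact: ip_norm_ge0.
have [c cv] := Tv; have [_ [Tw orth]] := riem_hess_desingP Mp fD Tv cv.
have [L [E [hLE vE]]] := tangent_desing_sub Mp Tv; rewrite vE in cv.
have [K [C [hKC wE]]] := tangent_desing_sub Mp Tw.
have [_ /(_ _ _ hKC)] := derive1_riem_grad_desing Mp fD hLE cv.
rewrite -wE; have /eqP := orth _ Tw; rewrite (ipBl inner) subr_eq0 => /eqP ->.
have fst_le (u : 'M[R]_(m, n) * 'M[R]_n) : frob_norm u.1 <= ip_norm ip u.
  rewrite -(@ler_pXn2r _ 2) ?nnegrE ?ip_norm_ge0 // frob_norm_sqr.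
  rewrite (ip_norm_sqr inner) lerDl mulr_ge0 ?(ltW alpha_gt0) //.
  exact: (ip_ge0 (inner_frob _ _)).
have hw := ip_tangent_vector_lower_bound alpha r_gt0 rn Mp hKC.
have hv := ip_tangent_vector_lower_bound alpha r_gt0 rn Mp hLE.
rewrite -wE -(ip_norm_sqr inner) in hw; rewrite -vE -(ip_norm_sqr inner) in hv.
have w_ge0 := ip_norm_ge0 ip w; have v_ge0 := ip_norm_ge0 ip v.
have cross := cross_term_le (ip_norm_ge0 _ K) (ip_norm_ge0 _ C)
  (ip_norm_ge0 _ L) (ip_norm_ge0 _ E) s_gt0 w_ge0 v_ge0 hw hv.
rewrite -(ip_norm_sqr inner) -/w => wwE.
have H1 : frob (ehess f X (L - X *m E)) (K - X *m C) <=
    D2 * ip_norm ip v * ip_norm ip w.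
  have D2_le : frob_norm (ehess f X (L - X *m E)) <= D2 * ip_norm ip v.
    have ehessE : ehess f X = 'd (egrad f) X.
      by apply/funext => V; rewrite /ehess deriveE.
    rewrite /D2 ehessE; apply: le_trans (frob_norm_le_op_norm _ _) _.
    rewrite -ehessE -/D2 ler_wpM2l // (le_trans _ (fst_le v)) // vE.
    exact: lexx.
  apply: le_trans (ip_cauchy_schwarz (inner_frob _ _) _ _) _.
  apply: ler_pM; rewrite ?ip_norm_ge0 //.
  by rewrite (le_trans _ (fst_le w)) // /w wE.
(* Moving [B] onto the normal gradient leaves a spectral norm on [(egrad f X) P], where
   Cauchy-Schwarz on the product would leave a Frobenius norm. *)
have HN (U : 'M[R]_(m, n)) (B : 'M[R]_n) :
    - frob (normal_grad alpha f X P) (U *m B) <=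
    N2 * (frob_norm U * frob_norm B).
  rewrite (ipC (inner_frob _ _)) frob_mulr -(ipNl (inner_frob _ _)).
  apply: le_trans (ip_cauchy_schwarz (inner_frob _ _) _ _) _.
  rewrite -scaleN1r (ip_normZ (inner_frob _ _)) normrN1 mul1r mulrCA.
  rewrite ler_wpM2l ?ip_norm_ge0 // -(frob_norm_tr B).
  exact: normal_grad_mulmx_le.
have H2 : - frob (normal_grad alpha f X P) (K *m E + L *m C) <=
    N2 * (s `^ (- 2^-1) * (ip_norm ip w * ip_norm ip v)).
  rewrite (ipDr (inner_frob _ _)) opprD.
  apply: le_trans (lerD (HN K E) (HN L C)) _.
  by rewrite -mulrDr ler_wpM2l.
have [w0|w_neq0] := eqVneq (ip_norm ip w) 0.
  by rewrite w0 mulr_ge0 ?ip_norm_ge0 // addr_ge0 // mulr_ge0 // powR_ge0.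
have w_gt0 : 0 < ip_norm ip w by rewrite lt_neqAle eq_sym w_neq0.
rewrite -(ler_pM2r w_gt0) -expr2 wwE; apply: le_trans (lerD H1 H2) _.
by rewrite le_eqVlt; apply/orP; left; apply/eqP; ring.
Qed.

End HessianBound.

Theorem proposition4p5 (R : realType) (m n r : nat)
    (hm : (0 < m)%N) (hn : (0 < n)%N) (hr : (0 < r)%N)
    (hrmn : (r < minn m n)%N)
    (alpha : R) (halpha : 0 < alpha)
    (f : 'M[R]_(m, n) -> R)
    (hf1 : C1_on setT (f : 'M[R]_(m, n) -> R^o))
    (hf2 : exists U : set 'M[R]_(m, n),
      [/\ open U, (forall X : 'M[R]_(m, n), (\rank X <= r)%N -> U X)
        & C2_on U f])
    (X : 'M[R]_(m, n)) (P : 'M[R]_n) (hXP : desing r (X, P)) :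
  let M := @desing R m n r in
  let ip := @ip_E R m n alpha in
  let g := @lift_fun R m n f in
  has_riem_hess ip M g (X, P) /\
  op_norm (tangent M (X, P)) (ip_norm ip) (ip_norm ip)
      (riem_hess ip M g (X, P))
    <= op_norm setT (@frob_norm R m n) (@frob_norm R m n) (ehess f X)
       + (2 * alpha + sigma r X ^+ 2) `^ (- 2^-1)
         * spectral_norm (egrad f X *m P).
Proof.
move=> M ip g.
have rn : (r <= n)%N by move: hrmn; rewrite leq_min => /andP[_ /ltnW].
have f_diff Y : differentiable (f : 'M[R]_(m, n) -> R^o) Y.
  by have [] := hf1 Y Logic.I.
have fD : differentiable (egrad f) X.
  have [U [_ rankU [_ UD]]] := hf2.
  by have [] := UD X (rankU _ (desing_rank rn hXP)).
have hessP v : tangent M (X, P) v ->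
    is_cov_deriv ip M (riem_grad ip M g) (X, P) v (riem_hess ip M g (X, P) v).
  by move=> Tv; apply: xgetPex; exact: ex_cov_deriv_desing.
split.
  split=> // q Mq; rewrite /ip /M /g (riem_grad_desing halpha f_diff Mq).
  exact: is_riem_grad_desing_grad.
rewrite {1}/op_norm; apply: ge_sup.
  (* [ge_sup] needs a nonempty set of values: the zero vector, written as the difference of a
     tangent vector with itself, is in the unit ball of the tangent space. *)
  have Tu := tangent_tangent_proj halpha 0 hXP.
  exists (ip_norm ip (riem_hess ip M g (X, P) 0)), 0 => //; split.
    by rewrite -[0](subrr (tangent_proj alpha (X, P) 0)); exact: tangent_desingB.
  by rewrite /ip_norm /ip (ip0l (inner_ip_E m n halpha)) sqrtr0 ler01.
move=> _ [v [Tv v_le1] <-].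
apply: le_trans (riem_hess_norm_le halpha f_diff hr rn hXP fD Tv) _.
rewrite ler_piMr // addr_ge0 ?mulr_ge0 ?powR_ge0 //.
- by apply: op_norm_ge0 => w; exact: ip_norm_ge0.
- by apply: op_norm_ge0 => w; exact: ip_norm_ge0.
Qed.
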